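(* Let $F:\mathbb{C}\to\mathbb{C}$ be an entire function, $F\not\equiv 0$, let $a\in\mathbb{C}$ be a node or focus of $\dot{x}=F(x)$, and let $\mathcal{N}$ be the basin of $F$ in $a$. Then $a$ lies in the topological interior $\mathring{\mathcal{N}}$ of $\mathcal{N}$, and $\mathcal{N}$ is open, connected and path-connected.
   Context: Consider the autonomous planar system $\dot{x}=F(x)$, $x\in\mathbb{C}$, $t\in\mathbb{R}$, with flow $\Phi(t,x)$ on the maximal interval of existence; $\Gamma(x)$ is the (full) orbit through $x$. $w_+(\Gamma)$ (resp. $w_-(\Gamma)$) is the positive (resp. negative) limit set of an orbit $\Gamma$, i.e. the set of all limits in $\mathbb{C}$ along sequences of times tending to the right (resp. left) endpoint of the maximal interval of existence. Equilibria are the zeros of $F$. A node or focus is a simple zero $a$ of $F$ that is attracting (stable) or repelling (unstable), i.e. all orbits through some neighborhood of $a$ tend to $a$ in positive time (attracting) or in negative time (repelling). The basin of $a$ is $\mathcal{N}=\{x\in\mathbb{C}: w_{+}(\Gamma(x))=\{a\}\}$ if $a$ is attracting, and $\mathcal{N}=\{x\in\mathbb{C}: w_{-}(\Gamma(x))=\{a\}\}$ if $a$ is repelling. *)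

(* Defs.v *)
From Stdlib Require Import Reals.
From Coquelicot Require Import Coquelicot.
Open Scope R_scope.

Definition entire (F : C -> C) : Prop :=
  forall z : C, @ex_derive C_AbsRing C_NormedModule F z.

Definition simple_zero (F : C -> C) (a : C) : Prop :=
  F a = RtoC 0 /\
  exists d : C, @is_derive C_AbsRing C_NormedModule F a d /\ d <> RtoC 0.

Definition in_interval (alpha omega : Rbar) (t : R) : Prop :=
  Rbar_lt alpha t /\ Rbar_lt t omega.

(* Only the values of [phi] on the interval are relevant. *)
Definition is_solution (F : C -> C) (alpha omega : Rbar) (phi : R -> C) : Prop :=
  forall t : R, in_interval alpha omega t ->
    @is_derive R_AbsRing C_R_NormedModule phi t (F (phi t)).

(* [phi] is t |-> Phi(t,x), and (alpha, omega) its maximal interval of existence.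
   Since F is defined on all of C, this interval is open. *)
Definition maximal_solution (F : C -> C) (x : C)
    (alpha omega : Rbar) (phi : R -> C) : Prop :=
  in_interval alpha omega 0 /\
  phi 0 = x /\
  is_solution F alpha omega phi /\
  forall (alpha' omega' : Rbar) (psi : R -> C),
    is_solution F alpha' omega' psi ->
    (forall t : R, in_interval alpha omega t ->
       in_interval alpha' omega' t /\ psi t = phi t) ->
    forall t : R, in_interval alpha' omega' t -> in_interval alpha omega t.

Definition limit_along (alpha omega : Rbar) (phi : R -> C) (e : Rbar) (p : C)
    : Prop :=
  exists t : nat -> R,
    (forall n : nat, in_interval alpha omega (t n)) /\
    is_lim_seq t e /\
    filterlim (fun n : nat => phi (t n)) eventually (locally p).

(* w_+(Gamma(x)) and w_-(Gamma(x)), as subsets of C; for entire F the maximal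
   solution through x exists and is unique. *)
Definition w_plus (F : C -> C) (x p : C) : Prop :=
  exists (alpha omega : Rbar) (phi : R -> C),
    maximal_solution F x alpha omega phi /\ limit_along alpha omega phi omega p.

Definition w_minus (F : C -> C) (x p : C) : Prop :=
  exists (alpha omega : Rbar) (phi : R -> C),
    maximal_solution F x alpha omega phi /\ limit_along alpha omega phi alpha p.

Definition attracting (F : C -> C) (a : C) : Prop :=
  exists U : C -> Prop, locally a U /\
    forall x : C, U x ->
    forall (alpha omega : Rbar) (phi : R -> C),
      maximal_solution F x alpha omega phi ->
      filterlim phi (within (in_interval alpha omega) (Rbar_locally omega))
        (locally a).

Definition repelling (F : C -> C) (a : C) : Prop :=
  exists U : C -> Prop, locally a U /\
    forall x : C, U x ->
    forall (alpha omega : Rbar) (phi : R -> C),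
      maximal_solution F x alpha omega phi ->
      filterlim phi (within (in_interval alpha omega) (Rbar_locally alpha))
        (locally a).

Definition node_or_focus (F : C -> C) (a : C) : Prop :=
  simple_zero F a /\ (attracting F a \/ repelling F a).

(* The set N is the basin of F in a. *)
Definition is_basin (F : C -> C) (a : C) (N : C -> Prop) : Prop :=
  (attracting F a /\
   forall x : C, N x <-> (forall p : C, w_plus F x p <-> p = a)) \/
  (repelling F a /\
   forall x : C, N x <-> (forall p : C, w_minus F x p <-> p = a)).

Definition C_interior (A : C -> Prop) (x : C) : Prop := locally x A.

Definition connected (A : C -> Prop) : Prop :=
  ~ exists U V : C -> Prop,
      open U /\ open V /\
      (forall x : C, A x -> U x \/ V x) /\
      (exists x : C, A x /\ U x) /\
      (exists x : C, A x /\ V x) /\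
      (forall x : C, ~ (A x /\ U x /\ V x)).

Definition path_connected (A : C -> Prop) : Prop :=
  forall x y : C, A x -> A y ->
    exists gamma : R -> C,
      continuous_on (fun s : R => 0 <= s <= 1) gamma /\
      gamma 0 = x /\ gamma 1 = y /\
      forall s : R, 0 <= s <= 1 -> A (gamma s).

(* Main.v *)
Require Import Defs.
From Stdlib Require Import Reals Lra Psatz Classical ClassicalEpsilon FunctionalExtensionality.
From Coquelicot Require Import Coquelicot.

(** Suppose that [a] is attracting, and take a disc around [a] from which all
    forward orbits converge to [a]. The basin is the set of points whose orbit
    meets this disc ([attracting_basin_reaches]): if [a] is a limit point of an
    orbit then the orbit enters the disc, and an orbit in the disc converges
    to [a]. The disc is thus a neighbourhood of [a] in the basin, and every point
    of the basin is joined to [a] inside the basin by a piece of its orbit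
    followed by a radius of the disc ([reaches_joined_center]). This gives path
    connectedness, and connectedness follows. The basin is open because the flow
    depends continuously on the initial point: being an interior point of the
    basin is a locally constant property along each orbit
    ([reaches_interior_along_orbit]), and it holds inside the disc. The
    repelling case is the attracting case for [- F] with time reversed.

    All of this needs existence, uniqueness and continuous dependence of
    solutions, while [F] is only known to be complex differentiable at every
    point. Rather than showing first that [F] is locally Lipschitz, which takes
    Cauchy's integral formula, the proof uses that the equation is autonomous and
    separates variables. Near a point where [F] does not vanish, [1 / F] is
    complex differentiable, so by Goursat's theorem on rectangles
    ([Goursat_rectangle]) it has a primitive [G] ([square_primitive]). The
    solutions there are the curves along which [G] grows at unit speed. The
    estimate that makes [G] a primitive also makes it a small perturbation of a
    linear map, hence injective, bilipschitz and locally onto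
    ([rectifying_chart], [quasi_linear_onto]); in the chart [G] the flow is a
    translation, and the three facts are read off ([local_flow],
    [local_uniqueness]). At a zero of [F] differentiability at this single point
    and Gronwall's argument show that only the constant solution passes through
    it ([equilibrium_locally_constant]). Gluing all solutions through a point
    gives the maximal one ([greatest_solution]). *)

Open Scope R_scope.

(** * The modulus as the metric of the plane *)

Lemma locally_Cmod (a : C) (P : C -> Prop) :
  locally a P <-> exists eps, 0 < eps /\ forall z, Cmod (z - a) < eps -> P z.
Proof.
  split.
  - intros [e He]. exists e. split; [apply cond_pos|].
    intros z Hz. apply He. apply C_NormedModule_mixin_compat1. exact Hz.
  - intros (e & He & H).
    assert (Hs : 0 < sqrt 2) by (apply sqrt_lt_R0; lra).
    assert (He' : 0 < e / sqrt 2) by (apply Rdiv_lt_0_compat; lra).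
    exists (mkposreal _ He'). intros z Hz. apply H.
    apply C_NormedModule_mixin_compat2 in Hz.
    replace (sqrt 2 * mkposreal _ He') with e in Hz by (simpl; field; lra).
    exact Hz.
Qed.

Lemma Cmod_sub_sym (z w : C) : Cmod (z - w) = Cmod (w - z).
Proof. rewrite <- Cmod_opp. f_equal. ring. Qed.

Lemma Cmod_sub_triangle (x y z : C) :
  Cmod (x - z) <= Cmod (x - y) + Cmod (y - z).
Proof.
  replace (x - z)%C with ((x - y) + (y - z))%C by ring. apply Cmod_triangle.
Qed.

Lemma Cmod_reverse_triangle (x y : C) : Cmod x - Cmod y <= Cmod (x - y).
Proof.
  assert (H := Cmod_triangle (x - y) y).
  replace (x - y + y)%C with x in H by ring. lra.
Qed.

Lemma Cmod_sub_eq_0 (z w : C) : Cmod (z - w) <= 0 -> z = w.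
Proof.
  intros H. assert (H0 := Cmod_ge_0 (z - w)).
  assert (E : (z - w)%C = 0%C) by (apply Cmod_eq_0; lra).
  replace z with ((z - w) + w)%C by ring. rewrite E. ring.
Qed.

Lemma Cmod_Re_Im (x y : R) : Cmod (x, y) <= Rabs x + Rabs y.
Proof.
  replace (x, y) with (RtoC x + Ci * RtoC y)%C
    by (unfold Ci, RtoC, Cplus, Cmult; simpl; f_equal; ring).
  eapply Rle_trans; [apply Cmod_triangle|].
  rewrite Cmod_mult, Cmod_Ci, !Cmod_R. lra.
Qed.

Lemma Rabs_fst_Cmod (z : C) : Rabs (fst z) <= Cmod z.
Proof. apply re_le_Cmod. Qed.

Lemma Rabs_snd_Cmod (z : C) : Rabs (snd z) <= Cmod z.
Proof. apply Rle_trans with (2 := Rmax_Cmod z). apply Rmax_r. Qed.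

(** * Derivatives in terms of the modulus *)

Definition has_C_derivative (f : C -> C) (z l : C) : Prop :=
  forall eps, 0 < eps -> exists delta, 0 < delta /\
    forall w, Cmod (w - z) < delta ->
      Cmod (f w - f z - l * (w - z)) <= eps * Cmod (w - z).

Definition has_velocity (phi : R -> C) (t : R) (l : C) : Prop :=
  forall eps, 0 < eps -> exists delta, 0 < delta /\
    forall s, Rabs (s - t) < delta ->
      Cmod (phi s - phi t - RtoC (s - t) * l) <= eps * Rabs (s - t).

Lemma has_C_derivative_of_is_derive (f : C -> C) (z l : C) :
  @is_derive C_AbsRing C_NormedModule f z l -> has_C_derivative f z l.
Proof.
  intros [_ H] eps Heps.
  destruct (H z (fun P HP => HP) (mkposreal eps Heps)) as [d H'].
  exists d. split; [apply cond_pos|]. intros w Hw.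
  specialize (H' w Hw).
  change (Cmod ((f w - f z) - (w - z) * l) <= eps * Cmod (w - z)) in H'.
  rewrite (Cmult_comm l). exact H'.
Qed.

Lemma norm_C_R_Cmod (z : C) : @norm R_AbsRing C_R_NormedModule z = Cmod z.
Proof.
  unfold norm; simpl. unfold prod_norm, Cmod. f_equal.
  unfold norm; simpl. unfold abs; simpl.
  change (Rabs (fst z) ^ 2 + Rabs (snd z) ^ 2 = fst z ^ 2 + snd z ^ 2).
  now rewrite !pow2_abs.
Qed.

Lemma scal_C_R_Cmult (t : R) (z : C) :
  @scal R_AbsRing C_R_NormedModule t z = (RtoC t * z)%C.
Proof.
  destruct z as [x y]. unfold scal; simpl. unfold prod_scal, scal; simpl.
  unfold mult; simpl. unfold RtoC, Cmult; simpl. f_equal; ring.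
Qed.

Lemma has_velocity_is_derive (phi : R -> C) (t : R) (l : C) :
  @is_derive R_AbsRing C_R_NormedModule phi t l <-> has_velocity phi t l.
Proof.
  split.
  - intros [_ H] eps Heps.
    destruct (H t (fun P HP => HP) (mkposreal eps Heps)) as [d Hd].
    exists d. split; [apply cond_pos|]. intros s Hs.
    specialize (Hd s Hs). rewrite norm_C_R_Cmod, scal_C_R_Cmult in Hd. exact Hd.
  - intros H. split; [apply is_linear_scal_l|].
    intros x Hx.
    assert (E : t = x) by (apply (is_filter_lim_locally_unique t x); exact Hx).
    subst x. intros eps.
    destruct (H eps (cond_pos eps)) as (d & Hd & H').
    exists (mkposreal d Hd). intros s Hs.
    rewrite norm_C_R_Cmod, scal_C_R_Cmult. exact (H' s Hs).
Qed.

Lemma has_C_derivative_bound (f : C -> C) (z l : C) :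
  has_C_derivative f z l -> exists K delta, 0 < K /\ 0 < delta /\
    forall w, Cmod (w - z) < delta -> Cmod (f w - f z) <= K * Cmod (w - z).
Proof.
  intros H. destruct (H 1 Rlt_0_1) as (d & Hd & H').
  exists (Cmod l + 1), d. assert (Hl := Cmod_ge_0 l).
  split; [lra|]. split; [exact Hd|]. intros w Hw. specialize (H' w Hw).
  assert (T := Cmod_reverse_triangle (f w - f z) (l * (w - z))).
  rewrite Cmod_mult in T. lra.
Qed.

Lemma has_C_derivative_continuous (f : C -> C) (z l : C) :
  has_C_derivative f z l -> forall eps, 0 < eps -> exists delta, 0 < delta /\
    forall w, Cmod (w - z) < delta -> Cmod (f w - f z) < eps.
Proof.
  intros H eps Heps.
  destruct (has_C_derivative_bound _ _ _ H) as (K & d & HK & Hd & B).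
  exists (Rmin d (eps / K)).
  assert (0 < eps / K) by (apply Rdiv_lt_0_compat; lra).
  split; [apply Rmin_glb_lt; lra|].
  intros w Hw. assert (H1 := Rmin_l d (eps / K)). assert (H2 := Rmin_r d (eps / K)).
  eapply Rle_lt_trans; [apply B; lra|].
  apply Rlt_le_trans with (K * (eps / K)); [apply Rmult_lt_compat_l; lra|].
  right; field; lra.
Qed.

Lemma has_velocity_bound (phi : R -> C) (t : R) (l : C) :
  has_velocity phi t l -> exists K delta, 0 < K /\ 0 < delta /\
    forall s, Rabs (s - t) < delta -> Cmod (phi s - phi t) <= K * Rabs (s - t).
Proof.
  intros H. destruct (H 1 Rlt_0_1) as (d & Hd & H').
  exists (Cmod l + 1), d. assert (Hl := Cmod_ge_0 l).
  split; [lra|]. split; [exact Hd|]. intros s Hs. specialize (H' s Hs).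
  assert (T := Cmod_reverse_triangle (phi s - phi t) (RtoC (s - t) * l)).
  rewrite Cmod_mult, Cmod_R in T. lra.
Qed.

Lemma has_velocity_continuous (phi : R -> C) (t : R) (l : C) :
  has_velocity phi t l -> forall eps, 0 < eps -> exists delta, 0 < delta /\
    forall s, Rabs (s - t) < delta -> Cmod (phi s - phi t) < eps.
Proof.
  intros H eps Heps.
  destruct (has_velocity_bound _ _ _ H) as (K & d & HK & Hd & B).
  exists (Rmin d (eps / K)).
  assert (0 < eps / K) by (apply Rdiv_lt_0_compat; lra).
  split; [apply Rmin_glb_lt; lra|].
  intros w Hw. assert (H1 := Rmin_l d (eps / K)). assert (H2 := Rmin_r d (eps / K)).
  eapply Rle_lt_trans; [apply B; lra|].
  apply Rlt_le_trans with (K * (eps / K)); [apply Rmult_lt_compat_l; lra|].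
  right; field; lra.
Qed.

(** The one chain rule needed mixes the two derivatives: a complex
    differentiable map carries a curve with velocity [l] to one with velocity
    [k * l]. *)
Lemma has_velocity_comp (f : C -> C) (phi : R -> C) (t : R) (k l : C) :
  has_C_derivative f (phi t) k -> has_velocity phi t l ->
  has_velocity (fun s => f (phi s)) t (k * l).
Proof.
  intros Hf Hphi eps Heps.
  destruct (has_velocity_bound _ _ _ Hphi) as (K & d1 & HK & Hd1 & B).
  assert (Hk := Cmod_ge_0 k).
  set (e1 := eps / (2 * K)). set (e2 := eps / (2 * (Cmod k + 1))).
  assert (He1 : 0 < e1) by (apply Rdiv_lt_0_compat; lra).
  assert (He2 : 0 < e2) by (apply Rdiv_lt_0_compat; lra).
  destruct (Hf e1 He1) as (d2 & Hd2 & F2).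
  destruct (has_velocity_continuous _ _ _ Hphi d2 Hd2) as (d3 & Hd3 & F3).
  destruct (Hphi e2 He2) as (d4 & Hd4 & F4).
  exists (Rmin d1 (Rmin d3 d4)).
  split; [repeat apply Rmin_glb_lt; lra|].
  intros s Hs.
  assert (M1 := Rmin_l d1 (Rmin d3 d4)). assert (M2 := Rmin_r d1 (Rmin d3 d4)).
  assert (M3 := Rmin_l d3 d4). assert (M4 := Rmin_r d3 d4).
  specialize (B s ltac:(lra)). specialize (F3 s ltac:(lra)).
  specialize (F4 s ltac:(lra)). specialize (F2 (phi s) F3).
  replace (f (phi s) - f (phi t) - RtoC (s - t) * (k * l))%C with
    ((f (phi s) - f (phi t) - k * (phi s - phi t))
     + k * (phi s - phi t - RtoC (s - t) * l))%C by ring.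
  eapply Rle_trans; [apply Cmod_triangle|]. rewrite Cmod_mult.
  assert (P := Rabs_pos (s - t)).
  assert (A1 : e1 * Cmod (phi s - phi t) <= eps / 2 * Rabs (s - t)).
  { apply Rle_trans with (e1 * (K * Rabs (s - t))).
    - apply Rmult_le_compat_l; lra.
    - right. unfold e1. field. lra. }
  assert (A2 : Cmod k * Cmod (phi s - phi t - RtoC (s - t) * l)
               <= eps / 2 * Rabs (s - t)).
  { apply Rle_trans with ((Cmod k + 1) * (e2 * Rabs (s - t))).
    - apply Rmult_le_compat; try apply Cmod_ge_0; lra.
    - right. unfold e2. field. lra. }
  lra.
Qed.

Lemma has_C_derivative_inv (f : C -> C) (z l : C) :
  f z <> 0%C -> has_C_derivative f z l ->
  has_C_derivative (fun w => / f w)%C z (- l / (f z * f z)).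
Proof.
  intros Hz H eps Heps.
  assert (P0 : 0 < Cmod (f z)) by (apply Cmod_gt_0; exact Hz).
  assert (Hl := Cmod_ge_0 l).
  set (m := Cmod (f z)) in *.
  destruct (has_C_derivative_bound _ _ _ H) as (K & d1 & HK & Hd1 & B).
  destruct (has_C_derivative_continuous _ _ _ H (m / 2) ltac:(lra))
    as (d2 & Hd2 & F2).
  (* Since |f w| stays above m / 2, the error term below splits into one
     fraction controlled by the differentiability of f and one by its
     Lipschitz bound K; d3 and d4 give each of them half of eps. *)
  assert (He1 : 0 < eps * (m * m) / 4)
    by (apply Rdiv_lt_0_compat; [repeat apply Rmult_lt_0_compat|]; lra).
  destruct (H _ He1) as (d3 & Hd3 & F3).
  set (d4 := eps * (m * m * m) / (4 * (Cmod l + 1) * K)).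
  assert (Hd4 : 0 < d4).
  { apply Rdiv_lt_0_compat; repeat apply Rmult_lt_0_compat; lra. }
  exists (Rmin (Rmin d1 d2) (Rmin d3 d4)).
  split; [repeat apply Rmin_glb_lt; lra|].
  intros w Hw.
  assert (M1 := Rmin_l (Rmin d1 d2) (Rmin d3 d4)).
  assert (M2 := Rmin_r (Rmin d1 d2) (Rmin d3 d4)).
  assert (M3 := Rmin_l d3 d4). assert (M4 := Rmin_r d3 d4).
  assert (M5 := Rmin_l d1 d2). assert (M6 := Rmin_r d1 d2).
  specialize (B w ltac:(lra)). specialize (F2 w ltac:(lra)).
  specialize (F3 w ltac:(lra)).
  assert (Hm : m / 2 < Cmod (f w)).
  { assert (T := Cmod_reverse_triangle (f z) (f w)).
    rewrite Cmod_sub_sym in T. fold m in T. lra. }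
  assert (Hw0 : f w <> 0%C) by (apply Cmod_gt_0; lra).
  set (D := Cmod (w - z)) in *.
  assert (HD : 0 <= D) by apply Cmod_ge_0.
  replace (/ f w - / f z - - l / (f z * f z) * (w - z))%C with
    (- (f w - f z - l * (w - z)) / (f w * f z)
     + l * (w - z) * (f w - f z) / (f w * (f z * f z)))%C
    by (field; split; assumption).
  eapply Rle_trans; [apply Cmod_triangle|].
  rewrite !Cmod_div by (repeat apply Cmult_neq_0; assumption).
  rewrite Cmod_opp, !Cmod_mult. fold m D.
  set (n := Cmod (f w)) in *.
  assert (A1 : Cmod (f w - f z - l * (w - z)) / (n * m) <= eps / 2 * D).
  { apply Rle_div_l; [apply Rmult_lt_0_compat; lra|].
    eapply Rle_trans; [exact F3|].
    replace (eps * (m * m) / 4 * D) with (eps / 2 * D * (m / 2 * m)) by field.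
    apply Rmult_le_compat_l; [apply Rmult_le_pos; lra|].
    apply Rmult_le_compat_r; lra. }
  assert (A2 : Cmod l * D * Cmod (f w - f z) / (n * (m * m)) <= eps / 2 * D).
  { apply Rle_div_l; [repeat apply Rmult_lt_0_compat; lra|].
    apply Rle_trans with ((Cmod l + 1) * D * (K * d4)).
    - apply Rmult_le_compat; [apply Rmult_le_pos; lra|apply Cmod_ge_0| |].
      + apply Rmult_le_compat_r; lra.
      + eapply Rle_trans; [exact B|]. apply Rmult_le_compat_l; lra.
    - replace ((Cmod l + 1) * D * (K * d4)) with (eps / 2 * D * (m / 2 * (m * m)))
        by (unfold d4; field; lra).
      apply Rmult_le_compat_l; [apply Rmult_le_pos; lra|].
      apply Rmult_le_compat_r; [|lra]. apply Rmult_le_pos; lra. }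
  lra.
Qed.

(** * Nested rectangles *)

Lemma nested_intervals (u v : nat -> R) :
  (forall n, u n <= u (S n)) -> (forall n, v (S n) <= v n) ->
  (forall n, u n <= v n) -> exists c, forall n, u n <= c <= v n.
Proof.
  intros Hu Hv Huv.
  assert (Mu : forall n k, u n <= u (n + k)%nat).
  { intros n k. induction k as [|k IH]; [rewrite Nat.add_0_r; lra|].
    rewrite Nat.add_succ_r. specialize (Hu (n + k)%nat). lra. }
  assert (Mv : forall n k, v (n + k)%nat <= v n).
  { intros n k. induction k as [|k IH]; [rewrite Nat.add_0_r; lra|].
    rewrite Nat.add_succ_r. specialize (Hv (n + k)%nat). lra. }
  assert (Muv : forall n m, u n <= v m).
  { intros n m. specialize (Mu n m). specialize (Mv m n).
    rewrite Nat.add_comm in Mv. specialize (Huv (n + m)%nat). lra. }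
  destruct (completeness (fun x => exists n, x = u n)) as [c [Hc1 Hc2]].
  - exists (v O). intros x [n ->]. apply Muv.
  - exists (u O), O. reflexivity.
  - exists c. intros n. split.
    + apply Hc1. now exists n.
    + apply Hc2. intros x [m ->]. apply Muv.
Qed.

Lemma half_pow_small (w delta : R) :
  0 < delta -> exists n, Rabs (w / 2 ^ n) < delta.
Proof.
  intros Hd.
  assert (H := is_lim_seq_geom (/ 2)).
  assert (A : Rabs (/ 2) < 1) by (rewrite Rabs_pos_eq; lra).
  specialize (H A). apply is_lim_seq_spec in H.
  assert (Hw := Rabs_pos w).
  assert (He : 0 < delta / (Rabs w + 1)) by (apply Rdiv_lt_0_compat; lra).
  destruct (H (mkposreal _ He)) as [N HN]. exists N.
  specialize (HN N (le_n _)). simpl in HN.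
  rewrite Rminus_0_r in HN.
  unfold Rdiv at 1. rewrite <- pow_inv, Rabs_mult.
  apply Rle_lt_trans with ((Rabs w + 1) * Rabs ((/ 2) ^ N)).
  - apply Rmult_le_compat_r; [apply Rabs_pos|lra].
  - apply Rlt_le_trans with ((Rabs w + 1) * (delta / (Rabs w + 1))).
    + apply Rmult_lt_compat_l; lra.
    + right; field; lra.
Qed.

(** Cousin's lemma for rectangles of a fixed shape. If [P] failed, it would fail
    for one quarter of the rectangle, for one quarter of that, and so on; the
    nested quarters shrink to a point near which [P] is supposed to hold. *)
Lemma rectangle_quadrisection (P : R -> R -> R -> R -> Prop) (x y w h : R) :
  0 <= w -> 0 <= h ->
  (forall x y w h, P x y (w / 2) (h / 2) -> P (x + w / 2) y (w / 2) (h / 2) ->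
     P x (y + h / 2) (w / 2) (h / 2) ->
     P (x + w / 2) (y + h / 2) (w / 2) (h / 2) -> P x y w h) ->
  (forall p q, x <= p <= x + w -> y <= q <= y + h ->
     exists delta, 0 < delta /\ forall x' y' w' h',
       0 <= w' < delta -> 0 <= h' < delta ->
       x' <= p <= x' + w' -> y' <= q <= y' + h' -> P x' y' w' h') ->
  P x y w h.
Proof.
  intros Hw Hh Hsub Hloc. apply NNPP. intros HP.
  set (W := fun n : nat => w / 2 ^ n). set (H := fun n : nat => h / 2 ^ n).
  assert (P2 : forall n, 0 < 2 ^ n) by (intros n; apply pow_lt; lra).
  assert (WS : forall n, W (S n) = W n / 2).
  { intros n. unfold W. simpl. specialize (P2 n). field. lra. }
  assert (HS : forall n, H (S n) = H n / 2).
  { intros n. unfold H. simpl. specialize (P2 n). field. lra. }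
  assert (W0 : forall n, 0 <= W n).
  { intros n. unfold W. apply Rle_mult_inv_pos; auto. }
  assert (H0 : forall n, 0 <= H n).
  { intros n. unfold H. apply Rle_mult_inv_pos; auto. }
  set (child := fun (n : nat) (q q' : R * R) =>
    (fst q' = fst q \/ fst q' = fst q + W n / 2) /\
    (snd q' = snd q \/ snd q' = snd q + H n / 2) /\
    (~ P (fst q) (snd q) (W n) (H n) -> ~ P (fst q') (snd q') (W (S n)) (H (S n)))).
  assert (Hchild : forall n q, exists q', child n q q').
  { intros n [a b]. unfold child; simpl.
    destruct (classic (P a b (W n) (H n))) as [Y|Y]; [exists (a, b); simpl; tauto|].
    rewrite WS, HS.
    destruct (classic (P a b (W n / 2) (H n / 2))) as [Y1|Y1];
      [|exists (a, b); simpl; tauto].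
    destruct (classic (P (a + W n / 2) b (W n / 2) (H n / 2))) as [Y2|Y2];
      [|exists (a + W n / 2, b); simpl; tauto].
    destruct (classic (P a (b + H n / 2) (W n / 2) (H n / 2))) as [Y3|Y3];
      [|exists (a, b + H n / 2); simpl; tauto].
    destruct (classic (P (a + W n / 2) (b + H n / 2) (W n / 2) (H n / 2))) as [Y4|Y4];
      [|exists (a + W n / 2, b + H n / 2); simpl; tauto].
    exfalso. apply Y, Hsub; assumption. }
  set (next := fun n q => proj1_sig (constructive_indefinite_description _ (Hchild n q))).
  assert (Hnext : forall n q, child n q (next n q)).
  { intros n q. unfold next. apply proj2_sig. }
  set (c := fix c (n : nat) : R * R :=
    match n with O => (x, y) | S n => next n (c n) end).
  assert (Hc : forall n, child n (c n) (c (S n))) by (intros n; apply Hnext).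
  assert (HcP : forall n, ~ P (fst (c n)) (snd (c n)) (W n) (H n)).
  { induction n as [|n IH].
    - simpl. unfold W, H. simpl. now rewrite !Rdiv_1_r.
    - apply (Hc n). exact IH. }
  destruct (nested_intervals (fun n => fst (c n)) (fun n => fst (c n) + W n))
    as [p Hp].
  { intros n. destruct (Hc n) as [[E|E] _]; rewrite E; specialize (W0 n); lra. }
  { intros n. rewrite WS. destruct (Hc n) as [[E|E] _]; rewrite E; specialize (W0 n); lra. }
  { intros n. specialize (W0 n); lra. }
  destruct (nested_intervals (fun n => snd (c n)) (fun n => snd (c n) + H n))
    as [q Hq].
  { intros n. destruct (Hc n) as [_ [[E|E] _]]; rewrite E; specialize (H0 n); lra. }
  { intros n. rewrite HS. destruct (Hc n) as [_ [[E|E] _]]; rewrite E; specialize (H0 n); lra. }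
  { intros n. specialize (H0 n); lra. }
  destruct (Hloc p q) as (d & Hd & HL).
  { specialize (Hp O). unfold W in Hp. simpl in Hp. now rewrite Rdiv_1_r in Hp. }
  { specialize (Hq O). unfold H in Hq. simpl in Hq. now rewrite Rdiv_1_r in Hq. }
  destruct (half_pow_small (w + h) d Hd) as [n Hn].
  assert (E : (w + h) / 2 ^ n = W n + H n) by (unfold W, H; specialize (P2 n); field; lra).
  rewrite E, Rabs_pos_eq in Hn by (specialize (W0 n); specialize (H0 n); lra).
  apply (HcP n), HL; auto; specialize (W0 n); specialize (H0 n); lra.
Qed.

(** * Integrals of complex-valued functions of a real variable *)

Definition continuous_at (g : R -> C) (t : R) : Prop :=
  forall eps, 0 < eps -> exists delta, 0 < delta /\
    forall s, Rabs (s - t) < delta -> Cmod (g s - g t) < eps.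

(** Integrating the components separately gives a value to every [g], so that
    primitives can be written as explicit formulas. *)
Definition CInt (g : R -> C) (a b : R) : C :=
  (RInt (fun t => fst (g t)) a b, RInt (fun t => snd (g t)) a b).

Lemma continuous_fst_snd (g : R -> C) (t : R) : continuous_at g t ->
  continuous (fun s => fst (g s)) t /\ continuous (fun s => snd (g s)) t.
Proof.
  intros H. split; apply filterlim_locally; intros [e He];
    destruct (H e He) as (d & Hd & H'); exists (mkposreal d Hd);
    intros s Hs; specialize (H' s Hs);
    [assert (T := Rabs_fst_Cmod (g s - g t)) | assert (T := Rabs_snd_Cmod (g s - g t))];
    (eapply Rle_lt_trans; [|exact H']); exact T.
Qed.

Lemma CInt_correct (g : R -> C) (a b : R) :
  (forall t, Rmin a b <= t <= Rmax a b -> continuous_at g t) ->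
  @is_RInt C_R_NormedModule g a b (CInt g a b).
Proof.
  intros H.
  apply (@is_RInt_fct_extend_pair R_NormedModule R_NormedModule);
    apply (@RInt_correct R_CompleteNormedModule);
    apply (@ex_RInt_continuous R_CompleteNormedModule);
    intros t Ht; destruct (continuous_fst_snd g t (H t Ht)); assumption.
Qed.

Lemma CInt_unique (g : R -> C) (a b : R) (l : C) :
  @is_RInt C_R_NormedModule g a b l -> CInt g a b = l.
Proof.
  intros H. destruct l as [l1 l2]. unfold CInt. f_equal; apply is_RInt_unique.
  - exact (@is_RInt_fct_extend_fst R_NormedModule R_NormedModule g a b _ H).
  - exact (@is_RInt_fct_extend_snd R_NormedModule R_NormedModule g a b _ H).
Qed.

Lemma CInt_Chasles (g : R -> C) (a b c : R) :
  (forall t, Rmin a b <= t <= Rmax a b -> continuous_at g t) ->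
  (forall t, Rmin b c <= t <= Rmax b c -> continuous_at g t) ->
  CInt g a c = (CInt g a b + CInt g b c)%C.
Proof.
  intros H1 H2. apply CInt_unique.
  exact (@is_RInt_Chasles C_R_NormedModule g a b c _ _
           (CInt_correct g a b H1) (CInt_correct g b c H2)).
Qed.

Lemma CInt_swap (g : R -> C) (a b : R) :
  (forall t, Rmin a b <= t <= Rmax a b -> continuous_at g t) ->
  CInt g b a = (- CInt g a b)%C.
Proof.
  intros H. apply CInt_unique.
  exact (@is_RInt_swap C_R_NormedModule g b a _ (CInt_correct g a b H)).
Qed.

Lemma is_RInt_affine (c d a b : R) :
  is_RInt (fun t => c + t * d) a b (c * (b - a) + d * ((b * b - a * a) / 2)).
Proof.
  evar_last.
  - apply (is_RInt_derive (fun t => c * t + d * (t * t) / 2)).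
    + intros t _. auto_derive; [trivial|]. field.
    + intros t _. apply (ex_derive_continuous (fun t => c + t * d)).
      auto_derive. trivial.
  - unfold minus, plus, opp; simpl. field.
Qed.

(** The comparison with an exactly integrated affine function serves twice: with
    the first-order expansion of [f] in Goursat's theorem, and with [d = 0] to
    estimate the increments of a primitive. *)
Lemma CInt_near_affine (g : R -> C) (a b M : R) (c d : C) :
  (forall t, Rmin a b <= t <= Rmax a b -> continuous_at g t) ->
  (forall t, Rmin a b <= t <= Rmax a b -> Cmod (g t - (c + RtoC t * d)) <= M) ->
  Cmod (CInt g a b - (c * RtoC (b - a) + d * RtoC ((b * b - a * a) / 2)))
    <= M * Rabs (b - a).
Proof.
  intros Hc HM.
  assert (HA : @is_RInt C_R_NormedModule (fun t => c + RtoC t * d)%C a b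
     (c * RtoC (b - a) + d * RtoC ((b * b - a * a) / 2))%C).
  { apply (@is_RInt_fct_extend_pair R_NormedModule R_NormedModule).
    - evar_last; [apply (is_RInt_ext (fun t => fst c + t * fst d))|].
      + intros t _. simpl. ring.
      + apply is_RInt_affine.
      + simpl. ring.
    - evar_last; [apply (is_RInt_ext (fun t => snd c + t * snd d))|].
      + intros t _. simpl. ring.
      + apply is_RInt_affine.
      + simpl. ring. }
  assert (HD := @is_RInt_minus C_R_NormedModule _ _ _ _ _ _ (CInt_correct g a b Hc) HA).
  rewrite (Rmult_comm M), <- norm_C_R_Cmod.
  eapply Rle_trans; [|eapply (@norm_RInt_le_const_abs C_R_NormedModule) with (2 := HD)].
  - right. reflexivity.
  - intros t Ht. rewrite norm_C_R_Cmod. exact (HM t Ht).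
Qed.

(** * Goursat's theorem and local primitives *)

Definition boundary_integral (f : C -> C) (x1 x2 y1 y2 : R) : C :=
  (CInt (fun t => f (t, y1)) x1 x2 + Ci * CInt (fun t => f (x2, t)) y1 y2
   - CInt (fun t => f (t, y2)) x1 x2 - Ci * CInt (fun t => f (x1, t)) y1 y2)%C.

Lemma continuous_at_horizontal (f : C -> C) (p q : R) (l : C) :
  has_C_derivative f (p, q) l -> continuous_at (fun t => f (t, q)) p.
Proof.
  intros H eps Heps.
  destruct (has_C_derivative_continuous _ _ _ H eps Heps) as (d & Hd & H').
  exists d. split; [exact Hd|]. intros s Hs. apply H'.
  replace ((s, q) - (p, q))%C with (RtoC (s - p))
    by (unfold RtoC, Cminus, Cplus, Copp; simpl; f_equal; ring).
  now rewrite Cmod_R.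
Qed.

Lemma continuous_at_vertical (f : C -> C) (p q : R) (l : C) :
  has_C_derivative f (p, q) l -> continuous_at (fun t => f (p, t)) q.
Proof.
  intros H eps Heps.
  destruct (has_C_derivative_continuous _ _ _ H eps Heps) as (d & Hd & H').
  exists d. split; [exact Hd|]. intros s Hs. apply H'.
  replace ((p, s) - (p, q))%C with (Ci * RtoC (s - q))%C
    by (unfold RtoC, Ci, Cminus, Cplus, Copp, Cmult; simpl; f_equal; ring).
  now rewrite Cmod_mult, Cmod_Ci, Cmod_R, Rmult_1_l.
Qed.

(** An affine function of [z] has boundary integral zero, so only its distance
    [M] to [f] counts, over a boundary of length [2 * (w + h)]. *)
Lemma boundary_integral_near_affine (f : C -> C) (x y w h M : R) (a b : C) :
  0 <= w -> 0 <= h ->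
  (forall p q, x <= p <= x + w -> y <= q <= y + h ->
     exists l, has_C_derivative f (p, q) l) ->
  (forall p q, x <= p <= x + w -> y <= q <= y + h ->
     Cmod (f (p, q) - (a + b * (p, q))) <= M) ->
  Cmod (boundary_integral f x (x + w) y (y + h)) <= M * (2 * (w + h)).
Proof.
  intros Hw Hh Hf HM.
  assert (Emin : Rmin x (x + w) = x /\ Rmax x (x + w) = x + w)
    by (split; [apply Rmin_left|apply Rmax_right]; lra).
  assert (Emin' : Rmin y (y + h) = y /\ Rmax y (y + h) = y + h)
    by (split; [apply Rmin_left|apply Rmax_right]; lra).
  assert (Hor : forall q, y <= q <= y + h ->
    Cmod (CInt (fun t => f (t, q)) x (x + w) -
      ((a + b * (Ci * RtoC q)) * RtoC (x + w - x)
        + b * RtoC (((x + w) * (x + w) - x * x) / 2))) <= M * w).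
  { intros q Hq. replace (M * w) with (M * Rabs (x + w - x))
      by (rewrite Rabs_pos_eq; [f_equal; ring|lra]).
    apply CInt_near_affine; destruct Emin as [-> ->]; intros t Ht.
    - destruct (Hf t q Ht Hq) as [l Hl]. exact (continuous_at_horizontal _ _ _ _ Hl).
    - replace (a + b * (Ci * RtoC q) + RtoC t * b)%C with (a + b * (t, q))%C
        by (destruct a, b; unfold RtoC, Ci, Cplus, Cmult; simpl; f_equal; ring).
      now apply HM. }
  assert (Ver : forall p, x <= p <= x + w ->
    Cmod (CInt (fun t => f (p, t)) y (y + h) -
      ((a + b * RtoC p) * RtoC (y + h - y)
        + (b * Ci) * RtoC (((y + h) * (y + h) - y * y) / 2))) <= M * h).
  { intros p Hp. replace (M * h) with (M * Rabs (y + h - y))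
      by (rewrite Rabs_pos_eq; [f_equal; ring|lra]).
    apply CInt_near_affine; destruct Emin' as [-> ->]; intros t Ht.
    - destruct (Hf p t Hp Ht) as [l Hl]. exact (continuous_at_vertical _ _ _ _ Hl).
    - replace (a + b * RtoC p + RtoC t * (b * Ci))%C with (a + b * (p, t))%C
        by (destruct a, b; unfold RtoC, Ci, Cplus, Cmult; simpl; f_equal; ring).
      now apply HM. }
  assert (H1 := Hor y ltac:(lra)). assert (H2 := Hor (y + h) ltac:(lra)).
  assert (V1 := Ver x ltac:(lra)). assert (V2 := Ver (x + w) ltac:(lra)).
  unfold boundary_integral.
  set (I1 := CInt _ x (x + w)) in H1 |- *.
  set (I2 := CInt (fun t => f (x + w, t)) _ _) in V2 |- *.
  set (I3 := CInt (fun t => f (t, y + h)) _ _) in H2 |- *.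
  set (I4 := CInt (fun t => f (x, t)) _ _) in V1 |- *.
  set (J1 := (_ + b * _)%C) in H1. set (J3 := (_ + b * RtoC (_ / 2))%C) in H2.
  set (J4 := (_ + b * Ci * _)%C) in V1. set (J2 := (_ + b * Ci * _)%C) in V2.
  assert (E : (J1 + Ci * J2 - J3 - Ci * J4)%C = 0%C).
  { unfold J1, J2, J3, J4. destruct a, b.
    unfold RtoC, Ci, Cminus, Cplus, Copp, Cmult; simpl; f_equal; field. }
  replace (I1 + Ci * I2 - I3 - Ci * I4)%C with
    ((I1 - J1) + Ci * (I2 - J2) + (- (I3 - J3) + - (Ci * (I4 - J4)))
     + (J1 + Ci * J2 - J3 - Ci * J4))%C by ring.
  rewrite E, Cplus_0_r.
  assert (T1 := Cmod_triangle (I1 - J1 + Ci * (I2 - J2)) (- (I3 - J3) + - (Ci * (I4 - J4)))).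
  assert (T2 := Cmod_triangle (I1 - J1) (Ci * (I2 - J2))).
  assert (T3 := Cmod_triangle (- (I3 - J3)) (- (Ci * (I4 - J4)))).
  rewrite !Cmod_opp, !Cmod_mult, !Cmod_Ci, !Rmult_1_l in *.
  lra.
Qed.

Lemma boundary_integral_quadrisection (f : C -> C) (x y w h : R) :
  0 <= w -> 0 <= h ->
  (forall p q, x <= p <= x + w -> y <= q <= y + h ->
     exists l, has_C_derivative f (p, q) l) ->
  boundary_integral f x (x + w) y (y + h) =
  (boundary_integral f x (x + w / 2) y (y + h / 2)
   + boundary_integral f (x + w / 2) (x + w / 2 + w / 2) y (y + h / 2)
   + boundary_integral f x (x + w / 2) (y + h / 2) (y + h / 2 + h / 2)
   + boundary_integral f (x + w / 2) (x + w / 2 + w / 2)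
       (y + h / 2) (y + h / 2 + h / 2))%C.
Proof.
  intros Hw Hh Hf.
  replace (x + w / 2 + w / 2) with (x + w) by field.
  replace (y + h / 2 + h / 2) with (y + h) by field.
  assert (Hor : forall q, y <= q <= y + h -> CInt (fun t => f (t, q)) x (x + w) =
    (CInt (fun t => f (t, q)) x (x + w / 2)
     + CInt (fun t => f (t, q)) (x + w / 2) (x + w))%C).
  { intros q Hq. apply CInt_Chasles; intros t;
      rewrite Rmin_left, Rmax_right by lra; intros Ht;
      destruct (Hf t q) as [l Hl]; try lra; exact (continuous_at_horizontal _ _ _ _ Hl). }
  assert (Ver : forall p, x <= p <= x + w -> CInt (fun t => f (p, t)) y (y + h) =
    (CInt (fun t => f (p, t)) y (y + h / 2)
     + CInt (fun t => f (p, t)) (y + h / 2) (y + h))%C).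
  { intros p Hp. apply CInt_Chasles; intros t;
      rewrite Rmin_left, Rmax_right by lra; intros Ht;
      destruct (Hf p t) as [l Hl]; try lra; exact (continuous_at_vertical _ _ _ _ Hl). }
  unfold boundary_integral.
  rewrite (Hor y), (Hor (y + h)), (Ver x), (Ver (x + w)) by lra. ring.
Qed.

(** The bound [eps * (w + h) ^ 2] is stable under quadrisection, because the
    boundary integral is additive while the bound is divided by four. It holds
    for small rectangles around a point by differentiability there: the error of
    the first-order expansion is at most [eps / 2 * (w + h)], and the boundary
    has length [2 * (w + h)]. *)
Theorem Goursat_rectangle (f : C -> C) (x y w h : R) :
  0 <= w -> 0 <= h ->
  (forall p q, x <= p <= x + w -> y <= q <= y + h ->
     exists l, has_C_derivative f (p, q) l) ->
  boundary_integral f x (x + w) y (y + h) = 0%C.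
Proof.
  intros Hw Hh Hf.
  assert (K : forall eps, 0 < eps ->
    Cmod (boundary_integral f x (x + w) y (y + h)) <= eps * ((w + h) * (w + h))).
  { intros eps Heps.
    pose (P := fun x' y' w' h' => 0 <= w' -> 0 <= h' ->
       x <= x' -> x' + w' <= x + w -> y <= y' -> y' + h' <= y + h ->
       Cmod (boundary_integral f x' (x' + w') y' (y' + h'))
         <= eps * ((w' + h') * (w' + h'))).
    enough (HP : P x y w h) by (apply HP; lra).
    apply rectangle_quadrisection; [assumption|assumption| |].
    - intros x' y' w' h' P1 P2 P3 P4 B1 B2 B3 B4 B5 B6.
      unfold P in *.
      rewrite boundary_integral_quadrisection;
        [|lra|lra|intros p q Hp Hq; apply Hf; lra].
      specialize (P1 ltac:(lra) ltac:(lra) ltac:(lra) ltac:(lra) ltac:(lra) ltac:(lra)).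
      specialize (P2 ltac:(lra) ltac:(lra) ltac:(lra) ltac:(lra) ltac:(lra) ltac:(lra)).
      specialize (P3 ltac:(lra) ltac:(lra) ltac:(lra) ltac:(lra) ltac:(lra) ltac:(lra)).
      specialize (P4 ltac:(lra) ltac:(lra) ltac:(lra) ltac:(lra) ltac:(lra) ltac:(lra)).
      eapply Rle_trans; [apply Cmod_triangle|].
      eapply Rle_trans; [apply Rplus_le_compat_r, Cmod_triangle|].
      eapply Rle_trans; [apply Rplus_le_compat_r, Rplus_le_compat_r, Cmod_triangle|].
      nra.
    - intros p q Hp Hq. destruct (Hf p q Hp Hq) as [l Hl].
      destruct (Hl (eps / 2) ltac:(lra)) as (d & Hd & Hloc).
      exists (d / 2). split; [lra|].
      intros x' y' w' h' Bw Bh Bx By _ _ B3 B4 B5 B6.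
      apply Rle_trans with (eps / 2 * (w' + h') * (2 * (w' + h'))); [|right; field].
      apply boundary_integral_near_affine with (a := (f (p, q) - l * (p, q))%C) (b := l);
        try lra.
      + intros p' q' Hp' Hq'. apply Hf; lra.
      + intros p' q' Hp' Hq'.
        assert (Hz : Cmod ((p', q') - (p, q)) <= w' + h').
        { apply Rle_trans with (Rabs (p' - p) + Rabs (q' - q)).
          - apply (Cmod_Re_Im (p' - p) (q' - q)).
          - apply Rplus_le_compat; apply Rabs_le; lra. }
        specialize (Hloc (p', q') ltac:(lra)).
        replace (f (p', q') - (f (p, q) - l * (p, q) + l * (p', q')))%C with
          (f (p', q') - f (p, q) - l * ((p', q') - (p, q)))%C by ring.
        eapply Rle_trans; [exact Hloc|]. apply Rmult_le_compat_l; lra. }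
  apply Cmod_eq_0. apply Rle_antisym; [|apply Cmod_ge_0].
  apply Rnot_lt_le. intros Hpos.
  set (m := Cmod (boundary_integral f x (x + w) y (y + h))) in *.
  set (A := (w + h) * (w + h)) in *.
  assert (HA : 0 <= A) by (unfold A; nra).
  assert (He : 0 < m / (2 * (A + 1))) by (apply Rdiv_lt_0_compat; lra).
  specialize (K _ He).
  assert (m / (2 * (A + 1)) * A <= m / (2 * (A + 1)) * (A + 1))
    by (apply Rmult_le_compat_l; lra).
  replace (m / (2 * (A + 1)) * (A + 1)) with (m / 2) in * by (field; lra).
  lra.
Qed.

(** The corners may come in any order: reversing a side only changes signs. *)
Lemma Goursat_corners (f : C -> C) (x1 x2 y1 y2 : R) :
  (forall p q, Rmin x1 x2 <= p <= Rmax x1 x2 -> Rmin y1 y2 <= q <= Rmax y1 y2 ->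
     exists l, has_C_derivative f (p, q) l) ->
  boundary_integral f x1 x2 y1 y2 = 0%C.
Proof.
  assert (Ord : forall x1 x2 y1 y2, x1 <= x2 -> y1 <= y2 ->
    (forall p q, x1 <= p <= x2 -> y1 <= q <= y2 ->
       exists l, has_C_derivative f (p, q) l) ->
    boundary_integral f x1 x2 y1 y2 = 0%C).
  { intros a b c d Hab Hcd Hf.
    replace b with (a + (b - a)) by ring. replace d with (c + (d - c)) by ring.
    apply Goursat_rectangle; [lra|lra|]. intros p q Hp Hq. apply Hf; lra. }
  assert (Half : forall x1 x2 y1 y2, y1 <= y2 ->
    (forall p q, Rmin x1 x2 <= p <= Rmax x1 x2 -> y1 <= q <= y2 ->
       exists l, has_C_derivative f (p, q) l) ->
    boundary_integral f x1 x2 y1 y2 = 0%C).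
  { intros a b c d Hcd Hf. destruct (Rle_dec a b) as [Hab|Hab].
    - rewrite Rmin_left, Rmax_right in Hf by lra. now apply Ord.
    - assert (E : boundary_integral f b a c d = 0%C).
      { rewrite Rmin_right, Rmax_left in Hf by lra. apply Ord; [lra|lra|exact Hf]. }
      unfold boundary_integral in *.
      rewrite (CInt_swap _ a b), (CInt_swap (fun t => f (t, d)) a b) in E.
      + transitivity (- 0)%C; [rewrite <- E; ring|ring].
      + intros t Ht. destruct (Hf t d Ht ltac:(lra)) as [l Hl].
        exact (continuous_at_horizontal _ _ _ _ Hl).
      + intros t Ht. destruct (Hf t c Ht ltac:(lra)) as [l Hl].
        exact (continuous_at_horizontal _ _ _ _ Hl). }
  intros Hf. destruct (Rle_dec y1 y2) as [Hy|Hy].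
  - apply Half; [exact Hy|]. intros p q Hp Hq. apply Hf; [exact Hp|].
    now rewrite Rmin_left, Rmax_right.
  - rewrite (Rmin_right y1), (Rmax_left y1) in Hf by lra.
    assert (E : boundary_integral f x1 x2 y2 y1 = 0%C)
      by (apply Half; [lra|exact Hf]).
    assert (Bx : Rmin x1 x2 <= x1 <= Rmax x1 x2)
      by (split; [apply Rmin_l|apply Rmax_l]).
    assert (Bx' : Rmin x1 x2 <= x2 <= Rmax x1 x2)
      by (split; [apply Rmin_r|apply Rmax_r]).
    unfold boundary_integral in *.
    rewrite (CInt_swap (fun t => f (x2, t)) y1 y2),
      (CInt_swap (fun t => f (x1, t)) y1 y2) in E.
    + transitivity (- 0)%C; [rewrite <- E; ring|ring].
    + intros t Ht. rewrite Rmin_right, Rmax_left in Ht by lra.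
      destruct (Hf x1 t Bx Ht) as [l Hl]. exact (continuous_at_vertical _ _ _ _ Hl).
    + intros t Ht. rewrite Rmin_right, Rmax_left in Ht by lra.
      destruct (Hf x2 t Bx' Ht) as [l Hl]. exact (continuous_at_vertical _ _ _ _ Hl).
Qed.

Definition in_square (p : C) (r : R) (z : C) : Prop :=
  Rabs (fst z - fst p) < r /\ Rabs (snd z - snd p) < r.

Definition between (a b t : R) : Prop := Rmin a b <= t <= Rmax a b.

Lemma between_abs (c r a b t : R) :
  Rabs (a - c) < r -> Rabs (b - c) < r -> between a b t -> Rabs (t - c) < r.
Proof.
  unfold between, Rmin, Rmax. intros Ha Hb Ht.
  apply Rabs_def2 in Ha, Hb. apply Rabs_def1; destruct (Rle_dec a b); lra.
Qed.

Lemma between_dist (a b t : R) : between a b t -> Rabs (t - a) <= Rabs (b - a).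
Proof.
  unfold between, Rmin, Rmax. intros Ht.
  destruct (Rle_dec a b).
  - rewrite !Rabs_pos_eq; lra.
  - rewrite !Rabs_left1; lra.
Qed.

(** The primitive integrates [f] from the centre, first horizontally and then
    vertically. By Goursat's theorem its increment from [z] to [w] is also the
    integral along a horizontal and a vertical segment from [z] to [w], whence
    the estimate. It yields at once that [f] is the derivative ([k = f z]) and
    that the primitive is close to linear ([k] the value at the centre). *)
Theorem square_primitive (f : C -> C) (p : C) (r : R) :
  (forall z, in_square p r z -> exists l, has_C_derivative f z l) ->
  exists G : C -> C, forall z w k M, in_square p r z -> in_square p r w ->
    (forall u, between (fst z) (fst w) (fst u) ->
       between (snd z) (snd w) (snd u) -> Cmod (f u - k) <= M) ->
    Cmod (G w - G z - k * (w - z)) <= 2 * M * Cmod (w - z).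
Proof.
  intros Hf. destruct p as [px py].
  set (hor := fun y a b => CInt (fun t => f (t, y)) a b).
  set (ver := fun x a b => CInt (fun t => f (x, t)) a b).
  exists (fun z => (hor py px (fst z) + Ci * ver (fst z) py (snd z))%C).
  intros [zx zy] [wx wy] k M [Hzx Hzy] [Hwx Hwy] HM. simpl in *.
  assert (Hr : 0 < r) by (apply Rle_lt_trans with (2 := Hzx), Rabs_pos).
  assert (Hpx : Rabs (px - px) < r) by (rewrite Rminus_diag, Rabs_R0; lra).
  assert (Hpy : Rabs (py - py) < r) by (rewrite Rminus_diag, Rabs_R0; lra).
  assert (Ch : forall a b y t, Rabs (a - px) < r -> Rabs (b - px) < r ->
     Rabs (y - py) < r -> Rmin a b <= t <= Rmax a b ->
     continuous_at (fun s => f (s, y)) t).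
  { intros a b y t Ha Hb Hy Ht.
    destruct (Hf (t, y)) as [l Hl].
    - split; [simpl; apply (between_abs px r a b t)|]; assumption.
    - exact (continuous_at_horizontal _ _ _ _ Hl). }
  assert (Cv : forall a b x t, Rabs (a - py) < r -> Rabs (b - py) < r ->
     Rabs (x - px) < r -> Rmin a b <= t <= Rmax a b ->
     continuous_at (fun s => f (x, s)) t).
  { intros a b x t Ha Hb Hx Ht.
    destruct (Hf (x, t)) as [l Hl].
    - split; [|simpl; apply (between_abs py r a b t)]; assumption.
    - exact (continuous_at_vertical _ _ _ _ Hl). }
  assert (E : (hor py px wx + Ci * ver wx py wy - (hor py px zx + Ci * ver zx py zy))%C
     = (hor zy zx wx + Ci * ver wx zy wy)%C).
  { unfold hor, ver.
    rewrite (CInt_Chasles (fun t => f (t, py)) px zx wx),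
      (CInt_Chasles (fun t => f (wx, t)) py zy wy); eauto.
    assert (Gou : boundary_integral f zx wx py zy = 0%C).
    { apply Goursat_corners. intros a b Ha Hb. apply Hf. split; simpl.
      - apply (between_abs px r zx wx); assumption.
      - apply (between_abs py r py zy); assumption. }
    unfold boundary_integral in Gou.
    match goal with |- ?L = ?R =>
      transitivity (R + 0)%C; [rewrite <- Gou; ring | ring] end. }
  rewrite E.
  assert (Bx : Cmod (hor zy zx wx - k * RtoC (wx - zx)) <= M * Rabs (wx - zx)).
  { assert (T := CInt_near_affine (fun t => f (t, zy)) zx wx M k 0).
    rewrite Cmult_0_l, Cplus_0_r in T. apply T.
    - intros t Ht. eauto.
    - intros t Ht. rewrite Cmult_0_r, Cplus_0_r. apply HM; simpl; [exact Ht|].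
      split; [apply Rmin_l|apply Rmax_l]. }
  assert (By : Cmod (ver wx zy wy - k * RtoC (wy - zy)) <= M * Rabs (wy - zy)).
  { assert (T := CInt_near_affine (fun t => f (wx, t)) zy wy M k 0).
    rewrite Cmult_0_l, Cplus_0_r in T. apply T.
    - intros t Ht. eauto.
    - intros t Ht. rewrite Cmult_0_r, Cplus_0_r. apply HM; simpl; [|exact Ht].
      split; [apply Rmin_r|apply Rmax_r]. }
  replace (hor zy zx wx + Ci * ver wx zy wy - k * ((wx, wy) - (zx, zy)))%C with
    ((hor zy zx wx - k * RtoC (wx - zx)) + Ci * (ver wx zy wy - k * RtoC (wy - zy)))%C.
  2:{ replace ((wx, wy) - (zx, zy))%C with (RtoC (wx - zx) + Ci * RtoC (wy - zy))%C
        by (unfold RtoC, Ci, Cminus, Cplus, Copp, Cmult; simpl; f_equal; ring). ring. }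
  eapply Rle_trans; [apply Cmod_triangle|].
  rewrite Cmod_mult, Cmod_Ci, Rmult_1_l.
  assert (M0 : 0 <= M).
  { apply Rle_trans with (Cmod (f (zx, zy) - k)); [apply Cmod_ge_0|].
    apply HM; split; simpl; [apply Rmin_l|apply Rmax_l|apply Rmin_l|apply Rmax_l]. }
  assert (A1 := Rabs_fst_Cmod ((wx, wy) - (zx, zy))).
  assert (A2 := Rabs_snd_Cmod ((wx, wy) - (zx, zy))).
  change (Rabs (wx - zx) <= Cmod ((wx, wy) - (zx, zy))) in A1.
  change (Rabs (wy - zy) <= Cmod ((wx, wy) - (zx, zy))) in A2.
  nra.
Qed.

(** The primitive [G] of [1 / F] is the complex time: along a solution it grows
    at unit speed. Near [p] it is a small perturbation of the multiplication by
    [c = 1 / F p], hence injective and bilipschitz. *)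
Lemma rectifying_chart (F : C -> C) (p : C) :
  (forall z, exists l, has_C_derivative F z l) -> F p <> 0%C ->
  exists (G : C -> C) (c : C) (r : R), 0 < r /\ 0 < Cmod c /\
    (forall z, Cmod (z - p) < r ->
       F z <> 0%C /\ has_C_derivative G z (/ F z)%C) /\
    (forall z w, Cmod (z - p) < r -> Cmod (w - p) < r ->
       Cmod (G w - G z - c * (w - z)) <= Cmod c / 2 * Cmod (w - z)).
Proof.
  intros HF Hp.
  assert (Pp : 0 < Cmod (F p)) by (apply Cmod_gt_0; exact Hp).
  set (f := fun z => (/ F z)%C).
  assert (Hf : forall z, F z <> 0%C -> exists l, has_C_derivative f z l).
  { intros z Hz. destruct (HF z) as [l Hl]. eexists.
    apply has_C_derivative_inv; eassumption. }
  assert (Pc : 0 < Cmod (f p)).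
  { unfold f. rewrite Cmod_inv by exact Hp. now apply Rinv_0_lt_compat. }
  destruct (HF p) as [l Hl].
  destruct (has_C_derivative_continuous _ _ _ Hl _ Pp) as (d1 & Hd1 & C1).
  destruct (Hf p Hp) as [l' Hl'].
  assert (Pc4 : 0 < Cmod (f p) / 4) by lra.
  destruct (has_C_derivative_continuous _ _ _ Hl' _ Pc4) as (d2 & Hd2 & C2).
  (* The square of half-side r lies in the disc of radius 2 * r. *)
  set (r := Rmin d1 d2 / 2).
  assert (Hr : 0 < r) by (unfold r; assert (0 < Rmin d1 d2) by (apply Rmin_glb_lt; lra); lra).
  assert (Sq : forall z, in_square p r z -> Cmod (z - p) < d1 /\ Cmod (z - p) < d2).
  { intros z [H1 H2].
    assert (T := Cmod_Re_Im (fst z - fst p) (snd z - snd p)).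
    change (fst z - fst p, snd z - snd p) with (z - p)%C in T.
    assert (M1 := Rmin_l d1 d2). assert (M2 := Rmin_r d1 d2).
    unfold r in *. lra. }
  assert (NZ : forall z, in_square p r z -> F z <> 0%C).
  { intros z Hz E. destruct (Sq z Hz) as [H1 _]. specialize (C1 z H1).
    rewrite E in C1. replace (0 - F p)%C with (- F p)%C in C1 by ring.
    rewrite Cmod_opp in C1. lra. }
  destruct (square_primitive f p r) as [G HG].
  { intros z Hz. apply Hf, NZ, Hz. }
  assert (DS : forall z, Cmod (z - p) < r -> in_square p r z).
  { intros z Hz. assert (A1 := Rabs_fst_Cmod (z - p)).
    assert (A2 := Rabs_snd_Cmod (z - p)).
    split; eapply Rle_lt_trans; try exact Hz; assumption. }
  assert (Box : forall z w u, in_square p r z -> in_square p r w ->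
     between (fst z) (fst w) (fst u) -> between (snd z) (snd w) (snd u) ->
     in_square p r u).
  { intros z w u [Z1 Z2] [W1 W2] U1 U2.
    split; [exact (between_abs _ _ _ _ _ Z1 W1 U1)|exact (between_abs _ _ _ _ _ Z2 W2 U2)]. }
  exists G, (f p), r. split; [exact Hr|]. split; [exact Pc|]. split.
  - intros z Hz. assert (Sz := DS z Hz). split; [exact (NZ z Sz)|].
    intros eps Heps.
    destruct (Hf z (NZ z Sz)) as [lz Hlz].
    destruct (has_C_derivative_continuous _ _ _ Hlz (eps / 2) ltac:(lra))
      as (d & Hd & Cz).
    exists (Rmin (d / 2) (r - Cmod (z - p))).
    split; [apply Rmin_glb_lt; lra|]. intros w Hw.
    assert (M1 := Rmin_l (d / 2) (r - Cmod (z - p))).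
    assert (M2 := Rmin_r (d / 2) (r - Cmod (z - p))).
    assert (Hwp : Cmod (w - p) < r)
      by (assert (T := Cmod_sub_triangle w z p); lra).
    apply Rle_trans with (2 * (eps / 2) * Cmod (w - z)); [|right; field].
    apply HG; [exact Sz|exact (DS w Hwp)|].
    intros u U1 U2. apply Rlt_le, Cz.
    assert (T := Cmod_Re_Im (fst u - fst z) (snd u - snd z)).
    change (fst u - fst z, snd u - snd z) with (u - z)%C in T.
    apply between_dist in U1, U2.
    assert (A1 := Rabs_fst_Cmod (w - z)). assert (A2 := Rabs_snd_Cmod (w - z)).
    change (Rabs (fst w - fst z) <= Cmod (w - z)) in A1.
    change (Rabs (snd w - snd z) <= Cmod (w - z)) in A2. lra.
  - intros z w Hz Hw.
    apply Rle_trans with (2 * (Cmod (f p) / 4) * Cmod (w - z)); [|right; field].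
    apply HG; [exact (DS z Hz)|exact (DS w Hw)|].
    intros u U1 U2. apply Rlt_le, C2. apply Sq.
    exact (Box z w u (DS z Hz) (DS w Hw) U1 U2).
Qed.

Lemma pow2_inv_small (m K : R) : (forall n, m <= K / 2 ^ n) -> m <= 0.
Proof.
  intros H. apply Rnot_lt_le. intros Hm.
  destruct (half_pow_small K m Hm) as [n Hn].
  specialize (H n). assert (T := Rle_abs (K / 2 ^ n)). lra.
Qed.

Lemma geometric_limit (w : nat -> C) (K : R) :
  (forall n k, Cmod (w (n + k)%nat - w n) <= K / 2 ^ n) ->
  exists l, forall n, Cmod (l - w n) <= 2 * K / 2 ^ n.
Proof.
  intros H.
  assert (Lim : forall u : nat -> R,
    (forall n k, Rabs (u (n + k)%nat - u n) <= K / 2 ^ n) ->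
    exists l, forall n, Rabs (l - u n) <= K / 2 ^ n).
  { intros u Hu.
    assert (Cau : ex_finite_lim_seq u).
    { apply ex_lim_seq_cauchy_corr. intros eps.
      destruct (half_pow_small (2 * K) eps (cond_pos eps)) as [N HN].
      exists N. intros n m Hn Hm.
      replace n with (N + (n - N))%nat by lia.
      replace m with (N + (m - N))%nat by lia.
      assert (H1 := Hu N (n - N)%nat). assert (H2 := Hu N (m - N)%nat).
      assert (T := Rle_abs (2 * K / 2 ^ N)).
      assert (P := pow_lt 2 N Rlt_0_2).
      replace (2 * K / 2 ^ N) with (K / 2 ^ N + K / 2 ^ N) in * by (field; lra).
      apply Rabs_le_between in H1, H2. apply Rabs_def1; lra. }
    destruct Cau as [l Hl]. exists l. intros n.
    assert (S1 : is_lim_seq (fun k => u (n + k)%nat) l).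
    { apply is_lim_seq_ext with (fun k => u (k + n)%nat).
      - intros k. f_equal. lia.
      - now apply is_lim_seq_incr_n. }
    apply Rabs_le. split.
    - assert (T := is_lim_seq_le (fun _ => u n - K / 2 ^ n) (fun k => u (n + k)%nat) 
        (u n - K / 2 ^ n) l).
      enough (u n - K / 2 ^ n <= l) by lra.
      apply T; [|apply is_lim_seq_const|exact S1].
      intros k. specialize (Hu n k). apply Rabs_le_between in Hu. lra.
    - assert (T := is_lim_seq_le (fun k => u (n + k)%nat) (fun _ => u n + K / 2 ^ n) 
        l (u n + K / 2 ^ n)).
      enough (l <= u n + K / 2 ^ n) by lra.
      apply T; [|exact S1|apply is_lim_seq_const].
      intros k. specialize (Hu n k). apply Rabs_le_between in Hu. lra. }
  destruct (Lim (fun n => fst (w n))) as [lx Hx].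
  { intros n k. eapply Rle_trans; [|apply (H n k)].
    exact (Rabs_fst_Cmod (w (n + k)%nat - w n)). }
  destruct (Lim (fun n => snd (w n))) as [ly Hy].
  { intros n k. eapply Rle_trans; [|apply (H n k)].
    exact (Rabs_snd_Cmod (w (n + k)%nat - w n)). }
  exists (lx, ly). intros n.
  assert (T := Cmod_Re_Im (lx - fst (w n)) (ly - snd (w n))).
  specialize (Hx n). specialize (Hy n).
  replace (2 * K / 2 ^ n) with (K / 2 ^ n + K / 2 ^ n)
    by (field; apply pow_nonzero; lra).
  eapply Rle_trans; [exact T|]. lra.
Qed.

(** The equation [G w = G z + tau] is solved by the contraction
    [T w = w - (G w - G z - tau) / c], of ratio 1/2, started at [z]. Its first
    step has length [rho = |tau| / |c|], so the iterates stay within [2 * rho]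
    of [z]. *)
Lemma quasi_linear_onto (G : C -> C) (c p z tau : C) (r : R) :
  0 < Cmod c ->
  (forall z w, Cmod (z - p) < r -> Cmod (w - p) < r ->
     Cmod (G w - G z - c * (w - z)) <= Cmod c / 2 * Cmod (w - z)) ->
  Cmod (z - p) < r / 2 -> Cmod tau < Cmod c * (r / 4) ->
  exists w, Cmod (w - p) < r /\ G w = (G z + tau)%C.
Proof.
  intros Hc HG Hz Htau.
  assert (Hc0 : c <> 0%C) by (apply Cmod_gt_0; exact Hc).
  set (rho := Cmod tau / Cmod c).
  assert (Hrho0 : 0 <= rho).
  { apply Rle_mult_inv_pos; [apply Cmod_ge_0|exact Hc]. }
  assert (Hrho : rho < r / 4).
  { apply Rlt_div_l; [exact Hc|]. lra. }
  set (T := fun w => (w - (G w - G z - tau) / c)%C).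
  assert (HT : forall u v, Cmod (u - p) < r -> Cmod (v - p) < r ->
    Cmod (T v - T u) <= Cmod (v - u) / 2).
  { intros u v Hu Hv. specialize (HG u v Hu Hv).
    replace (T v - T u)%C with (- (G v - G u - c * (v - u)) / c)%C
      by (unfold T; field; exact Hc0).
    rewrite Cmod_div, Cmod_opp by exact Hc0.
    apply Rle_div_l; [exact Hc|]. lra. }
  set (w := fix w (n : nat) : C := match n with O => z | S n => T (w n) end).
  assert (Inv : forall n, Cmod (w n - z) <= 2 * rho - 2 * rho / 2 ^ n /\
     Cmod (w (S n) - w n) <= rho / 2 ^ n).
  { induction n as [|n [I1 I2]].
    - change (w O) with z. change (w 1%nat) with (T z).
      rewrite !Rdiv_1_r. replace (z - z)%C with (RtoC 0) by ring. rewrite Cmod_0.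
      split; [lra|].
      replace (T z - z)%C with (tau / c)%C by (unfold T; field; exact Hc0).
      rewrite Cmod_div by exact Hc0. unfold rho. lra.
    - assert (P := pow_lt 2 n Rlt_0_2).
      assert (Q : 0 <= rho / 2 ^ n) by (apply Rle_mult_inv_pos; assumption).
      assert (E1 : 2 * rho / 2 ^ S n = rho / 2 ^ n) by (simpl; field; lra).
      assert (E2 : 2 * rho / 2 ^ n = 2 * (rho / 2 ^ n)) by (field; lra).
      assert (E3 : rho / 2 ^ S n = rho / 2 ^ n / 2) by (simpl; field; lra).
      rewrite E1, E3. rewrite E2 in I1.
      assert (B : Cmod (w (S n) - z) <= 2 * rho - rho / 2 ^ n)
        by (assert (Tri := Cmod_sub_triangle (w (S n)) (w n) z); lra).
      split; [exact B|].
      change (w (S (S n)) - w (S n))%C with (T (w (S n)) - T (w n))%C.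
      eapply Rle_trans; [apply HT|lra].
      + assert (Tri := Cmod_sub_triangle (w n) z p). lra.
      + assert (Tri := Cmod_sub_triangle (w (S n)) z p). lra. }
  assert (Near : forall n, Cmod (w n - z) <= 2 * rho).
  { intros n. destruct (Inv n) as [I _].
    assert (0 <= 2 * rho / 2 ^ n)
      by (apply Rle_mult_inv_pos; [lra|apply pow_lt; lra]). lra. }
  destruct (geometric_limit w (2 * rho)) as [l Hl].
  { intros n k.
    assert (P := pow_lt 2 n Rlt_0_2).
    enough (Cmod (w (n + k)%nat - w n) <= 2 * rho / 2 ^ n - 2 * rho / 2 ^ (n + k)).
    { assert (0 <= 2 * rho / 2 ^ (n + k))
        by (apply Rle_mult_inv_pos; [lra|apply pow_lt; lra]). lra. }
    induction k as [|k IH].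
    - rewrite Nat.add_0_r. replace (w n - w n)%C with (RtoC 0) by ring.
      rewrite Cmod_0. lra.
    - rewrite Nat.add_succ_r. destruct (Inv (n + k)%nat) as [_ I].
      assert (P' := pow_lt 2 (n + k) Rlt_0_2).
      replace (2 * rho / 2 ^ S (n + k)) with (rho / 2 ^ (n + k)) by (simpl; field; lra).
      replace (2 * rho / 2 ^ (n + k)) with (2 * (rho / 2 ^ (n + k))) in IH by (field; lra).
      assert (Tri := Cmod_sub_triangle (w (S (n + k))) (w (n + k)%nat) (w n)).
      lra. }
  assert (Hlz : Cmod (l - z) <= 2 * rho).
  { enough (Cmod (l - z) - 2 * rho <= 0) by lra.
    apply pow2_inv_small with (2 * (2 * rho)). intros n.
    specialize (Hl n). specialize (Near n).
    assert (Tri := Cmod_sub_triangle l (w n) z). lra. }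
  assert (Hlp : Cmod (l - p) < r)
    by (assert (Tri := Cmod_sub_triangle l z p); lra).
  exists l. split; [exact Hlp|].
  assert (Fix : T l = l).
  { apply Cmod_sub_eq_0. apply pow2_inv_small with (8 * rho). intros n.
    assert (Hn := Hl n). assert (Hn1 := Hl (S n)).
    assert (P := pow_lt 2 n Rlt_0_2).
    replace (2 * (2 * rho) / 2 ^ S n) with (2 * (rho / 2 ^ n)) in Hn1 by (simpl; field; lra).
    replace (2 * (2 * rho) / 2 ^ n) with (4 * (rho / 2 ^ n)) in Hn by (simpl; field; lra).
    replace (8 * rho / 2 ^ n) with (8 * (rho / 2 ^ n)) by (field; lra).
    assert (B := HT (w n) l).
    assert (Hwn : Cmod (w n - p) < r)
      by (assert (Tri := Cmod_sub_triangle (w n) z p); specialize (Near n); lra).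
    specialize (B Hwn Hlp). change (T (w n)) with (w (S n)) in B.
    assert (Tri := Cmod_sub_triangle (T l) (w (S n)) l).
    rewrite (Cmod_sub_sym (w (S n)) l) in Tri.
    assert (0 <= rho / 2 ^ n) by (apply Rle_mult_inv_pos; assumption).
    lra. }
  assert (E : ((G l - G z - tau) / c)%C = 0%C).
  { replace ((G l - G z - tau) / c)%C with (l - T l)%C by (unfold T; ring).
    rewrite Fix. ring. }
  replace (G l) with ((G l - G z - tau) / c * c + G z + tau)%C by (field; exact Hc0).
  rewrite E. ring.
Qed.

(** * Local existence, uniqueness and continuous dependence *)

(** In the chart the flow is a translation: [Psi t z] is the point with
    [G (Psi t z) = G z + t]. Its derivative is that of an inverse function, and
    since translations are isometries the distortion of [Psi t] is at most the
    ratio [(3/2 * |c|) / (|c| / 2) = 3] of the two Lipschitz constants of the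
    chart. *)
Lemma local_flow (F : C -> C) (p : C) :
  (forall z, exists l, has_C_derivative F z l) -> F p <> 0%C ->
  exists (rho delta K : R) (Psi : R -> C -> C), 0 < rho /\ 0 < delta /\ 0 < K /\
    (forall z, Cmod (z - p) < rho -> Psi 0 z = z) /\
    (forall z t, Cmod (z - p) < rho -> Rabs t < delta ->
       has_velocity (fun s => Psi s z) t (F (Psi t z))) /\
    (forall z w t, Cmod (z - p) < rho -> Cmod (w - p) < rho -> Rabs t < delta ->
       Cmod (Psi t w - Psi t z) <= K * Cmod (w - z)).
Proof.
  intros HF Hp.
  destruct (rectifying_chart F p HF Hp) as (G & c & r & Hr & Hc & HG & Hlin).
  assert (Hlow : forall z w, Cmod (z - p) < r -> Cmod (w - p) < r ->
    Cmod c / 2 * Cmod (w - z) <= Cmod (G w - G z)).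
  { intros z w Hz Hw. specialize (Hlin z w Hz Hw).
    assert (T := Cmod_reverse_triangle (c * (w - z)) (G w - G z)).
    rewrite (Cmod_sub_sym (c * _)), Cmod_mult in T. lra. }
  assert (Hup : forall z w, Cmod (z - p) < r -> Cmod (w - p) < r ->
    Cmod (G w - G z) <= 3 / 2 * Cmod c * Cmod (w - z)).
  { intros z w Hz Hw. specialize (Hlin z w Hz Hw).
    assert (T := Cmod_reverse_triangle (G w - G z) (c * (w - z))).
    rewrite Cmod_mult in T. lra. }
  set (Q := fun t z w => Cmod (w - p) < r /\ G w = (G z + RtoC t)%C).
  set (Psi := fun t z => epsilon (inhabits z) (Q t z)).
  assert (Hd : 0 < Cmod c * (r / 4)) by (apply Rmult_lt_0_compat; lra).
  assert (HPsi : forall z t, Cmod (z - p) < r / 2 -> Rabs t < Cmod c * (r / 4) ->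
    Q t z (Psi t z)).
  { intros z t Hz Ht. apply epsilon_spec.
    destruct (quasi_linear_onto G c p z (RtoC t) r Hc Hlin Hz) as [w Hw].
    - now rewrite Cmod_R.
    - exists w. exact Hw. }
  exists (r / 2), (Cmod c * (r / 4)), 3, Psi.
  split; [lra|]. split; [exact Hd|]. split; [lra|]. repeat split.
  - intros z Hz. destruct (HPsi z 0 Hz) as [H1 H2]; [now rewrite Rabs_R0|].
    apply Cmod_sub_eq_0.
    assert (T := Hlow z (Psi 0 z) ltac:(lra) H1). rewrite H2 in T.
    replace (G z + RtoC 0 - G z)%C with (RtoC 0) in T by ring.
    rewrite Cmod_0 in T. nra.
  - intros z t Hz Ht eps Heps.
    destruct (HPsi z t Hz Ht) as [H1 H2].
    destruct (HG _ H1) as [Hnz HG'].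
    set (m := Cmod (F (Psi t z))).
    assert (Hm : 0 < m) by (apply Cmod_gt_0; exact Hnz).
    assert (He : 0 < eps * Cmod c / (2 * m))
      by (apply Rdiv_lt_0_compat; [apply Rmult_lt_0_compat|]; lra).
    destruct (HG' _ He) as (d & Hd' & B).
    exists (Rmin (Cmod c / 2 * d) (Cmod c * (r / 4) - Rabs t)).
    split; [apply Rmin_glb_lt; [apply Rmult_lt_0_compat|]; lra|].
    intros s Hs.
    assert (M1 := Rmin_l (Cmod c / 2 * d) (Cmod c * (r / 4) - Rabs t)).
    assert (M2 := Rmin_r (Cmod c / 2 * d) (Cmod c * (r / 4) - Rabs t)).
    assert (Hs' : Rabs s < Cmod c * (r / 4)).
    { assert (T := Rabs_triang (s - t) t). replace (s - t + t) with s in T by ring. lra. }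
    destruct (HPsi z s Hz Hs') as [H3 H4].
    assert (E : (G (Psi s z) - G (Psi t z))%C = RtoC (s - t)).
    { rewrite H2, H4, RtoC_minus. ring. }
    assert (L := Hlow _ _ H1 H3). rewrite E, Cmod_R in L.
    set (D := Cmod (Psi s z - Psi t z)) in *.
    assert (HD : 0 <= D) by apply Cmod_ge_0.
    specialize (B (Psi s z)). rewrite E in B. fold D in B.
    assert (B' := B ltac:(nra)).
    replace (Psi s z - Psi t z - RtoC (s - t) * F (Psi t z))%C with
      (- F (Psi t z) * (RtoC (s - t) - / F (Psi t z) * (Psi s z - Psi t z)))%C
      by (field; exact Hnz).
    rewrite Cmod_mult, Cmod_opp. fold m.
    apply Rle_trans with (m * (eps * Cmod c / (2 * m) * D)).
    + apply Rmult_le_compat_l; lra.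
    + replace (m * (eps * Cmod c / (2 * m) * D)) with (eps * (Cmod c / 2 * D))
        by (field; lra).
      apply Rmult_le_compat_l; lra.
  - intros z w t Hz Hw Ht.
    destruct (HPsi z t Hz Ht) as [Z1 Z2]. destruct (HPsi w t Hw Ht) as [W1 W2].
    assert (L := Hlow _ _ Z1 W1). assert (U := Hup z w ltac:(lra) ltac:(lra)).
    rewrite Z2, W2 in L.
    replace (G w + RtoC t - (G z + RtoC t))%C with (G w - G z)%C in L by ring.
    apply Rmult_le_reg_l with (Cmod c / 2); [lra|]. lra.
Qed.

Lemma zero_velocity_constant (g : R -> C) (t eta : R) :
  (forall s, Rabs (s - t) < eta -> has_velocity g s 0) ->
  forall s, Rabs (s - t) < eta -> g s = g t.
Proof.
  intros H s Hs.
  assert (D : forall u, Rabs (u - t) <= Rabs (s - t) ->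
    @is_derive R_AbsRing C_R_NormedModule g u zero).
  { intros u Hu. apply has_velocity_is_derive. apply H. lra. }
  destruct (Rtotal_order s t) as [L|[E|L]].
  - apply (@eq_is_derive C_R_NormedModule); [|exact L].
    intros u Hu. apply D. rewrite !Rabs_left1; lra.
  - now rewrite E.
  - symmetry. apply (@eq_is_derive C_R_NormedModule); [|exact L].
    intros u Hu. apply D. rewrite !Rabs_pos_eq; lra.
Qed.

Lemma has_velocity_minus (phi psi : R -> C) (t : R) (k l : C) :
  has_velocity phi t k -> has_velocity psi t l ->
  has_velocity (fun s => phi s - psi s)%C t (k - l).
Proof.
  intros H1 H2. apply has_velocity_is_derive in H1, H2.
  apply has_velocity_is_derive.
  exact (@is_derive_minus R_AbsRing C_R_NormedModule _ _ _ _ _ H1 H2).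
Qed.

Lemma has_velocity_fst_snd (phi : R -> C) (t : R) (l : C) :
  has_velocity phi t l ->
  is_derive (fun s => fst (phi s)) t (fst l) /\
  is_derive (fun s => snd (phi s)) t (snd l).
Proof.
  intros H. split; (split; [apply is_linear_scal_l|]);
    intros x Hx;
    assert (E : t = x) by (apply (is_filter_lim_locally_unique t x); exact Hx);
    subst x; intros eps; destruct (H eps (cond_pos eps)) as (d & Hd & H');
    exists (mkposreal d Hd); intros s Hs; specialize (H' s Hs);
    (eapply Rle_trans; [|exact H']).
  - eapply Rle_trans; [|apply Rabs_fst_Cmod]. right.
    unfold norm; simpl. unfold abs; simpl. f_equal.
    unfold minus, plus, opp, scal; simpl. unfold mult; simpl. ring.
  - eapply Rle_trans; [|apply Rabs_snd_Cmod]. right.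
    unfold norm; simpl. unfold abs; simpl. f_equal.
    unfold minus, plus, opp, scal; simpl. unfold mult; simpl. ring.
Qed.

(** Multiplying [g] by [exp (- K * s)] makes it nonincreasing to the right of [t],
    and multiplying by [exp (K * s)] makes it nondecreasing to the left. *)
Lemma Gronwall_zero (g dg : R -> R) (K t eta : R) :
  (forall s, Rabs (s - t) < eta -> is_derive g s (dg s)) ->
  (forall s, Rabs (s - t) < eta -> Rabs (dg s) <= K * g s) ->
  g t = 0 -> forall s, Rabs (s - t) < eta -> g s <= 0.
Proof.
  intros Hd Hb Ht s Hs.
  assert (Hder : forall k u, Rabs (u - t) < eta ->
    is_derive (fun v => g v * exp (k * v)) u ((dg u + k * g u) * exp (k * u))).
  { intros k u Hu. specialize (Hd u Hu). evar_last.
    - apply (is_derive_mult g (fun v => exp (k * v)) u (dg u) (k * exp (k * u)));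
        [exact Hd| |intros; apply Rmult_comm].
      auto_derive; [trivial|ring].
    - unfold plus, mult; simpl. ring. }
  assert (Hcl : forall u, Rmin t s <= u <= Rmax t s -> Rabs (u - t) < eta).
  { intros u Hu. eapply Rle_lt_trans; [|exact Hs]. exact (between_dist t s u Hu). }
  assert (MV : forall k, exists u, Rmin t s <= u <= Rmax t s /\
    g s * exp (k * s) = (dg u + k * g u) * exp (k * u) * (s - t)).
  { intros k.
    destruct (MVT_gen (fun v => g v * exp (k * v)) t s
      (fun u => (dg u + k * g u) * exp (k * u))) as (u & Hu & E).
    - intros u Hu. apply Hder, Hcl. lra.
    - intros u Hu. apply derivable_continuous_pt.
      exists ((dg u + k * g u) * exp (k * u)). apply is_derive_Reals, Hder, Hcl, Hu.
    - exists u. split; [exact Hu|]. rewrite Ht in E. lra. }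
  enough (exists k, g s * exp (k * s) <= 0) as [k Hk].
  { assert (P := exp_pos (k * s)). nra. }
  destruct (Rle_dec t s) as [L|L].
  - exists (- K). destruct (MV (- K)) as (u & Hu & ->).
    assert (B := Hb u (Hcl u Hu)). assert (T := Rle_abs (dg u)).
    assert (P := exp_pos (- K * u)).
    assert ((dg u + - K * g u) * exp (- K * u) <= 0) by nra. nra.
  - exists K. destruct (MV K) as (u & Hu & ->).
    assert (B := Hb u (Hcl u Hu)). assert (T := Rcomplements.Rabs_maj2 (dg u)).
    assert (P := exp_pos (K * u)).
    assert (0 <= (dg u + K * g u) * exp (K * u)) by (apply Rmult_le_pos; lra). nra.
Qed.

Definition solves_near (F : C -> C) (phi : R -> C) (t : R) : Prop :=
  exists eta, 0 < eta /\
    forall s, Rabs (s - t) < eta -> has_velocity phi s (F (phi s)).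

(** Differentiability at a zero [p] of [F] bounds the speed by [K * |phi - p|];
    Gronwall's argument applied to [|phi - p| ^ 2] then keeps the solution
    at [p]. *)
Lemma equilibrium_locally_constant (F : C -> C) (phi : R -> C) (t : R) (l : C) :
  has_C_derivative F (phi t) l -> F (phi t) = 0%C -> solves_near F phi t ->
  exists delta, 0 < delta /\ forall s, Rabs (s - t) < delta -> phi s = phi t.
Proof.
  intros HF H0 (eta & Heta & Hphi).
  destruct (has_C_derivative_bound _ _ _ HF) as (K & d & HK & Hd & B).
  rewrite H0 in B.
  assert (Hvt : has_velocity phi t (F (phi t)))
    by (apply Hphi; rewrite Rminus_diag, Rabs_R0; lra).
  destruct (has_velocity_continuous _ _ _ Hvt d Hd) as (d' & Hd' & Cont).
  exists (Rmin eta d'). split; [apply Rmin_glb_lt; lra|].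
  set (p := phi t) in *.
  set (x := fun s => fst (phi s) - fst p). set (y := fun s => snd (phi s) - snd p).
  intros s Hs.
  assert (HD : forall s, Rabs (s - t) < Rmin eta d' ->
    Rabs (s - t) < eta /\ Rabs (s - t) < d').
  { intros u Hu. assert (M1 := Rmin_l eta d'). assert (M2 := Rmin_r eta d'). lra. }
  assert (Sq : forall s, Cmod (phi s - p) * Cmod (phi s - p) = x s * x s + y s * y s).
  { intros u. unfold Cmod. rewrite sqrt_def; [|nra].
    unfold x, y. simpl. ring. }
  assert (G := Gronwall_zero (fun s => x s * x s + y s * y s)
    (fun s => 2 * (x s * fst (F (phi s)) + y s * snd (F (phi s))))
    (4 * K) t (Rmin eta d')).
  cbv beta in G.
  assert (Hle : x s * x s + y s * y s <= 0).
  { apply G; [| | |exact Hs]; clear G.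
    - intros u Hu. destruct (HD u Hu) as [Hu1 _].
      destruct (has_velocity_fst_snd _ _ _ (Hphi u Hu1)) as [Dx Dy].
      assert (Dx' : is_derive x u (fst (F (phi u)))).
      { unfold x. evar_last; [apply (is_derive_minus (fun v => fst (phi v)) (fun _ => fst p))|].
        - exact Dx.
        - apply is_derive_const.
        - unfold minus, plus, opp, zero; simpl; ring. }
      assert (Dy' : is_derive y u (snd (F (phi u)))).
      { unfold y. evar_last; [apply (is_derive_minus (fun v => snd (phi v)) (fun _ => snd p))|].
        - exact Dy.
        - apply is_derive_const.
        - unfold minus, plus, opp, zero; simpl; ring. }
      evar_last.
      + apply (is_derive_plus (fun s => x s * x s) (fun s => y s * y s)).
        * apply (is_derive_mult x x); [exact Dx'|exact Dx'|intros; apply Rmult_comm].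
        * apply (is_derive_mult y y); [exact Dy'|exact Dy'|intros; apply Rmult_comm].
      + unfold plus, mult; simpl. ring.
    - intros u Hu. destruct (HD u Hu) as [_ Hu2].
      specialize (B (phi u) (Cont u Hu2)).
      replace (F (phi u) - RtoC 0)%C with (F (phi u)) in B by ring.
      rewrite <- Sq. set (m := Cmod (phi u - p)) in *.
      assert (Hm : 0 <= m) by apply Cmod_ge_0.
      assert (A1 := Rabs_fst_Cmod (phi u - p)). assert (A2 := Rabs_snd_Cmod (phi u - p)).
      change (Rabs (x u) <= m) in A1. change (Rabs (y u) <= m) in A2.
      assert (A3 := Rabs_fst_Cmod (F (phi u))). assert (A4 := Rabs_snd_Cmod (F (phi u))).
      rewrite Rabs_mult, (Rabs_pos_eq 2) by lra.
      eapply Rle_trans; [apply Rmult_le_compat_l; [lra|apply Rabs_triang]|].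
      rewrite !Rabs_mult.
      assert (P1 : Rabs (x u) * Rabs (fst (F (phi u))) <= m * (K * m))
        by (apply Rmult_le_compat; try apply Rabs_pos; lra).
      assert (P2 : Rabs (y u) * Rabs (snd (F (phi u))) <= m * (K * m))
        by (apply Rmult_le_compat; try apply Rabs_pos; lra).
      lra.
    - unfold x, y, p. ring. }
  rewrite <- Sq in Hle. apply Cmod_sub_eq_0.
  assert (P := Cmod_ge_0 (phi s - p)). nra.
Qed.

(** Away from the zeros of [F], the complex time [G] along two solutions has the
    same derivative 1, hence the same value, and [G] is injective. At a zero,
    both solutions are constant. *)
Lemma local_uniqueness (F : C -> C) (phi psi : R -> C) (t : R) :
  (forall z, exists l, has_C_derivative F z l) ->
  solves_near F phi t -> solves_near F psi t -> phi t = psi t ->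
  exists delta, 0 < delta /\ forall s, Rabs (s - t) < delta -> phi s = psi s.
Proof.
  intros HF Hphi Hpsi E.
  destruct (classic (F (phi t) = 0%C)) as [Z|NZ].
  - destruct (HF (phi t)) as [l Hl].
    destruct (equilibrium_locally_constant F phi t l Hl Z Hphi) as (d1 & Hd1 & C1).
    rewrite E in Hl, Z.
    destruct (equilibrium_locally_constant F psi t l Hl Z Hpsi) as (d2 & Hd2 & C2).
    exists (Rmin d1 d2). split; [apply Rmin_glb_lt; lra|]. intros s Hs.
    assert (M1 := Rmin_l d1 d2). assert (M2 := Rmin_r d1 d2).
    rewrite C1, C2 by lra. exact E.
  - destruct Hphi as (e1 & He1 & H1). destruct Hpsi as (e2 & He2 & H2).
    set (p := phi t) in *.
    destruct (rectifying_chart F p HF NZ) as (G & c & r & Hr & Hc & HG & Hlin).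
    assert (T0 : forall e, 0 < e -> Rabs (t - t) < e)
      by (intros e He; rewrite Rminus_diag, Rabs_R0; lra).
    destruct (has_velocity_continuous _ _ _ (H1 t (T0 _ He1)) r Hr) as (d1 & Hd1 & C1).
    destruct (has_velocity_continuous _ _ _ (H2 t (T0 _ He2)) r Hr) as (d2 & Hd2 & C2).
    fold p in C1. rewrite <- E in C2.
    set (e := Rmin (Rmin e1 e2) (Rmin d1 d2)).
    exists e. split; [unfold e; repeat apply Rmin_glb_lt; lra|].
    assert (He : forall s, Rabs (s - t) < e -> Rabs (s - t) < e1 /\ Rabs (s - t) < e2 /\
      Rabs (s - t) < d1 /\ Rabs (s - t) < d2).
    { intros s Hs. unfold e in Hs.
      assert (M1 := Rmin_l (Rmin e1 e2) (Rmin d1 d2)).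
      assert (M2 := Rmin_r (Rmin e1 e2) (Rmin d1 d2)).
      assert (M3 := Rmin_l e1 e2). assert (M4 := Rmin_r e1 e2).
      assert (M5 := Rmin_l d1 d2). assert (M6 := Rmin_r d1 d2). lra. }
    intros s Hs.
    assert (Const := zero_velocity_constant (fun s => G (phi s) - G (psi s))%C t e).
    cbv beta in Const. rewrite <- E in Const. fold p in Const.
    assert (EG : (G (phi s) - G (psi s))%C = (G p - G p)%C).
    { apply Const; [|exact Hs]. intros u Hu.
      destruct (He u Hu) as (U1 & U2 & U3 & U4).
      destruct (HG _ (C1 u U3)) as [N1 D1]. destruct (HG _ (C2 u U4)) as [N2 D2].
      assert (V1 := has_velocity_comp _ _ _ _ _ D1 (H1 u U1)).
      assert (V2 := has_velocity_comp _ _ _ _ _ D2 (H2 u U2)).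
      rewrite Cinv_l in V1, V2 by assumption.
      assert (V := has_velocity_minus _ _ _ _ _ V1 V2).
      replace (RtoC 1 - RtoC 1)%C with (RtoC 0) in V by ring. exact V. }
    destruct (He s Hs) as (_ & _ & S3 & S4).
    specialize (Hlin (psi s) (phi s) (C2 s S4) (C1 s S3)).
    rewrite EG in Hlin.
    replace (G p - G p - c * (phi s - psi s))%C with (- (c * (phi s - psi s)))%C
      in Hlin by ring.
    rewrite Cmod_opp, Cmod_mult in Hlin.
    apply Cmod_sub_eq_0. assert (P := Cmod_ge_0 (phi s - psi s)). nra.
Qed.

(** * Intervals of time *)

(** Connectedness of an interval, in the form in which it is used for the
    uniqueness of solutions, for the openness of the basin, and for the passage
    from paths to connectedness. *)
Lemma locally_constant_on_interval (D P : R -> Prop) :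
  (forall s t u, D s -> D t -> s <= u <= t -> D u) ->
  (forall t, D t -> exists delta, 0 < delta /\
     forall s, D s -> Rabs (s - t) < delta -> (P s <-> P t)) ->
  forall s t, D s -> D t -> P s -> P t.
Proof.
  intros HD HP.
  assert (K : forall s t, D s -> D t -> s <= t -> (P t <-> P s)).
  { intros s t Hs Ht Hst.
    set (E := fun u => s <= u <= t /\ forall v, s <= v <= u -> (P v <-> P s)).
    assert (Es : E s).
    { split; [lra|]. intros v Hv. replace v with s by lra. tauto. }
    destruct (completeness E) as [m [Hm1 Hm2]].
    - exists t. intros u [Hu _]. lra.
    - now exists s.
    - assert (Hsm : s <= m) by (apply Hm1, Es).
      assert (Hmt : m <= t) by (apply Hm2; intros u [Hu _]; lra).
      assert (Below : forall e, 0 < e -> exists u, E u /\ m - e < u).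
      { intros e He. apply NNPP. intros N.
        assert (m <= m - e); [|lra]. apply Hm2. intros u Hu.
        apply Rnot_lt_le. intros Hlt. apply N. now exists u. }
      destruct (HP m (HD s t m Hs Ht ltac:(lra))) as (d & Hd & Hloc).
      destruct (Below d Hd) as (u & Eu & Hu).
      assert (Hum : u <= m) by (apply Hm1, Eu).
      assert (Hloc' : forall v, s <= v <= t -> Rabs (v - m) < d -> (P v <-> P s)).
      { intros v Hv Hvm. assert (Hut := proj1 Eu).
        assert (Pu := proj2 Eu u ltac:(lra)).
        assert (Pum := Hloc u (HD s t u Hs Ht Hut) ltac:(apply Rabs_def1; lra)).
        assert (Pvm := Hloc v (HD s t v Hs Ht Hv) Hvm). tauto. }
      assert (Ext : E (Rmin t (m + d / 2))).
      { assert (M1 := Rmin_l t (m + d / 2)). assert (M2 := Rmin_r t (m + d / 2)).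
        assert (M3 : m <= Rmin t (m + d / 2)) by (apply Rmin_glb; lra).
        split; [lra|]. intros v Hv.
        destruct (Rle_dec v u) as [Hvu|Hvu].
        - apply (proj2 Eu). lra.
        - apply Hloc'; [lra|]. apply Rabs_def1; lra. }
      assert (Hmin : Rmin t (m + d / 2) <= m) by apply Hm1, Ext.
      assert (Emin : Rmin t (m + d / 2) = t).
      { apply Rmin_left. unfold Rmin in Hmin. destruct (Rle_dec t (m + d / 2)); lra. }
      rewrite Emin in Ext. apply (proj2 Ext). lra. }
  intros s t Hs Ht. destruct (Rle_dec s t) as [L|L].
  - apply (K s t); assumption.
  - apply (K t s); [assumption|assumption|lra].
Qed.

Lemma in_interval_convex (alpha omega : Rbar) (s t u : R) :
  in_interval alpha omega s -> in_interval alpha omega t -> s <= u <= t ->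
  in_interval alpha omega u.
Proof.
  unfold in_interval. destruct alpha, omega; simpl; intros; lra || tauto.
Qed.

Lemma in_interval_open (alpha omega : Rbar) (t : R) :
  in_interval alpha omega t -> exists delta, 0 < delta /\
    forall s, Rabs (s - t) < delta -> in_interval alpha omega s.
Proof.
  unfold in_interval. destruct alpha as [a| |], omega as [o| |]; simpl; try tauto; intros [H1 H2].
  - exists (Rmin (t - a) (o - t)). split; [apply Rmin_glb_lt; lra|].
    intros s Hs. assert (M1 := Rmin_l (t - a) (o - t)).
    assert (M2 := Rmin_r (t - a) (o - t)). apply Rabs_def2 in Hs. lra.
  - exists (t - a). split; [lra|]. intros s Hs. apply Rabs_def2 in Hs. split; [lra|trivial].
  - exists (o - t). split; [lra|]. intros s Hs. apply Rabs_def2 in Hs. split; [trivial|lra].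
  - exists 1. split; [lra|]. tauto.
Qed.

Lemma in_interval_shift (alpha omega : Rbar) (T t : R) :
  in_interval (Rbar_minus alpha T) (Rbar_minus omega T) t <->
  in_interval alpha omega (t + T).
Proof.
  unfold in_interval. destruct alpha, omega; simpl; split; intros []; split; lra || tauto.
Qed.

Lemma in_interval_opp (alpha omega : Rbar) (t : R) :
  in_interval (Rbar_opp omega) (Rbar_opp alpha) t <-> in_interval alpha omega (- t).
Proof.
  unfold in_interval. destruct alpha, omega; simpl; split; intros []; split; lra || tauto.
Qed.

Lemma sequence_to_right_end (alpha omega : Rbar) (t : R) :
  in_interval alpha omega t -> exists u : nat -> R,
    (forall n, in_interval alpha omega (u n)) /\ is_lim_seq u omega.
Proof.
  intros Ht. assert (Ht' := Ht). destruct Ht' as [H1 H2].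
  destruct omega as [o| |]; [| |destruct H2].
  - exists (fun n => o - (o - t) * / (INR n + 1)). split.
    + intros n. assert (P := pos_INR n). simpl in H2.
      assert (P1 : 0 < / (INR n + 1)) by (apply Rinv_0_lt_compat; lra).
      assert (P2 : / (INR n + 1) <= 1).
      { rewrite <- Rinv_1. apply Rinv_le_contravar; lra. }
      assert (t <= o - (o - t) * / (INR n + 1) < o) by nra.
      split; [|simpl; lra].
      destruct alpha as [a| |]; simpl in *; lra || tauto.
    + replace (Finite o) with (Rbar_minus o (Rbar_mult (o - t) 0))
        by (simpl; f_equal; ring).
      apply is_lim_seq_minus'; [apply is_lim_seq_const|].
      apply (is_lim_seq_scal_l _ _ 0).
      apply (is_lim_seq_inv _ p_infty); [|discriminate].
      apply is_lim_seq_ext with (fun n => INR (S n)).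
      * intros n. apply S_INR.
      * apply -> is_lim_seq_incr_1. apply is_lim_seq_INR.
  - exists (fun n => t + INR n). split.
    + intros n. assert (P := pos_INR n). split; [|exact I].
      destruct alpha as [a| |]; simpl in *; lra || tauto.
    + evar_last.
      * apply is_lim_seq_plus with (l1 := t) (l2 := p_infty);
          [apply is_lim_seq_const|apply is_lim_seq_INR|reflexivity].
      * reflexivity.
Qed.

(** * Maximal solutions *)

Definition solution_through (F : C -> C) (x : C) (alpha omega : Rbar) (phi : R -> C) : Prop :=
  in_interval alpha omega 0 /\ phi 0 = x /\ is_solution F alpha omega phi.

Lemma is_solution_velocity (F : C -> C) (alpha omega : Rbar) (phi : R -> C) :
  is_solution F alpha omega phi <->
  forall t, in_interval alpha omega t -> has_velocity phi t (F (phi t)).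
Proof.
  split; intros H t Ht; apply has_velocity_is_derive, H, Ht.
Qed.

Lemma is_solution_solves_near (F : C -> C) (alpha omega : Rbar) (phi : R -> C) (t : R) :
  is_solution F alpha omega phi -> in_interval alpha omega t -> solves_near F phi t.
Proof.
  intros H Ht. destruct (in_interval_open _ _ _ Ht) as (d & Hd & Hi).
  exists d. split; [exact Hd|]. intros s Hs.
  apply (proj1 (is_solution_velocity _ _ _ _) H), Hi, Hs.
Qed.

Lemma has_velocity_ext_near (phi psi : R -> C) (t delta : R) (l : C) :
  0 < delta -> (forall s, Rabs (s - t) < delta -> phi s = psi s) ->
  has_velocity phi t l -> has_velocity psi t l.
Proof.
  intros Hd Heq H eps Heps. destruct (H eps Heps) as (d & Hd' & B).
  exists (Rmin d delta). split; [apply Rmin_glb_lt; lra|]. intros s Hs.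
  assert (M1 := Rmin_l d delta). assert (M2 := Rmin_r d delta).
  rewrite <- (Heq s), <- (Heq t); [apply B| |]; try lra.
  rewrite Rminus_diag, Rabs_R0. lra.
Qed.

(** Only [k = 1] (translation of time) and [k = -1] (reversal) occur. *)
Lemma has_velocity_affine_time (phi : R -> C) (k T t : R) (l : C) :
  Rabs k = 1 -> has_velocity phi (k * t + T) l ->
  has_velocity (fun s => phi (k * s + T)) t (RtoC k * l).
Proof.
  intros Hk H eps Heps. destruct (H eps Heps) as (d & Hd & B).
  exists d. split; [exact Hd|]. intros s Hs.
  assert (E : Rabs (k * s + T - (k * t + T)) = Rabs (s - t)).
  { replace (k * s + T - (k * t + T)) with (k * (s - t)) by ring.
    now rewrite Rabs_mult, Hk, Rmult_1_l. }
  specialize (B (k * s + T)). rewrite E in B. specialize (B Hs).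
  replace (RtoC (s - t) * (RtoC k * l))%C with (RtoC (k * s + T - (k * t + T)) * l)%C.
  - exact B.
  - replace (k * s + T - (k * t + T)) with ((s - t) * k) by ring.
    rewrite RtoC_mult. ring.
Qed.

Lemma is_solution_shift (F : C -> C) (alpha omega : Rbar) (phi : R -> C) (T : R) :
  is_solution F alpha omega phi ->
  is_solution F (Rbar_minus alpha T) (Rbar_minus omega T) (fun t => phi (t + T)).
Proof.
  rewrite !is_solution_velocity. intros H t Ht. apply in_interval_shift in Ht.
  apply has_velocity_ext_near with (fun s => phi (1 * s + T)) 1; [lra| |].
  - intros s _. f_equal. ring.
  - replace (F (phi (t + T))) with (RtoC 1 * F (phi (t + T)%R))%C by ring.
    apply has_velocity_affine_time; [apply Rabs_R1|].
    replace (1 * t + T) with (t + T) by ring. apply H, Ht.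
Qed.

Lemma is_solution_opp (F : C -> C) (alpha omega : Rbar) (phi : R -> C) :
  is_solution F alpha omega phi ->
  is_solution (fun z => - F z)%C (Rbar_opp omega) (Rbar_opp alpha) (fun t => phi (- t)).
Proof.
  rewrite !is_solution_velocity. intros H t Ht. apply in_interval_opp in Ht.
  apply has_velocity_ext_near with (fun s => phi (-1 * s + 0)) 1; [lra| |].
  - intros s _. f_equal. ring.
  - replace (- F (phi (- t)%R))%C with (RtoC (-1) * F (phi (- t)%R))%C
      by (unfold RtoC, Cmult, Copp; simpl; destruct (F _); simpl; f_equal; ring).
    apply has_velocity_affine_time; [rewrite Rabs_left; lra|].
    replace (-1 * t + 0) with (- t) by ring. apply H, Ht.
Qed.

Lemma solution_uniqueness (F : C -> C) (alpha omega alpha' omega' : Rbar)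
    (phi psi : R -> C) (s t : R) :
  (forall z, exists l, has_C_derivative F z l) ->
  is_solution F alpha omega phi -> is_solution F alpha' omega' psi ->
  in_interval alpha omega s -> in_interval alpha' omega' s ->
  in_interval alpha omega t -> in_interval alpha' omega' t ->
  phi s = psi s -> phi t = psi t.
Proof.
  intros HF Hphi Hpsi S1 S2 T1 T2.
  apply (locally_constant_on_interval
    (fun u => in_interval alpha omega u /\ in_interval alpha' omega' u)
    (fun u => phi u = psi u)); [| |tauto|tauto].
  - intros u v w [U1 U2] [V1 V2] Hw. split;
      [exact (in_interval_convex _ _ _ _ _ U1 V1 Hw)
      |exact (in_interval_convex _ _ _ _ _ U2 V2 Hw)].
  - intros u [U1 U2].
    destruct (classic (phi u = psi u)) as [E|N].
    + destruct (local_uniqueness F phi psi u HF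
        (is_solution_solves_near _ _ _ _ _ Hphi U1)
        (is_solution_solves_near _ _ _ _ _ Hpsi U2) E) as (d & Hd & H).
      exists d. split; [exact Hd|]. intros v _ Hv. specialize (H v Hv). tauto.
    + assert (V := has_velocity_minus _ _ _ _ _
        (proj1 (is_solution_velocity _ _ _ _) Hphi u U1)
        (proj1 (is_solution_velocity _ _ _ _) Hpsi u U2)).
      assert (P : 0 < Cmod (phi u - psi u)).
      { apply Rnot_le_lt. intros L. now apply N, Cmod_sub_eq_0. }
      destruct (has_velocity_continuous _ _ _ V _ P) as (d & Hd & H).
      exists d. split; [exact Hd|]. intros v _ Hv. split; [|tauto].
      intros Ev. exfalso. specialize (H v Hv). cbv beta in H.
      rewrite Ev, Cmod_sub_sym in H.
      replace (phi u - psi u - (psi v - psi v))%C with (phi u - psi u)%C in H by ring.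
      lra.
Qed.

Lemma local_existence (F : C -> C) (x : C) :
  (forall z, exists l, has_C_derivative F z l) ->
  exists alpha omega phi, solution_through F x alpha omega phi.
Proof.
  intros HF. destruct (classic (F x = 0%C)) as [Z|NZ].
  - exists m_infty, p_infty, (fun _ => x).
    split; [split; exact I|]. split; [reflexivity|].
    apply is_solution_velocity. intros t _. rewrite Z. intros eps Heps.
    exists 1. split; [lra|]. intros s _.
    replace (x - x - RtoC (s - t) * RtoC 0)%C with (RtoC 0) by ring.
    rewrite Cmod_0. apply Rmult_le_pos; [lra|apply Rabs_pos].
  - destruct (local_flow F x HF NZ) as (rho & d & K & Psi & Hrho & Hd & _ & H0 & HV & _).
    assert (Hx : Cmod (x - x) < rho).
    { replace (x - x)%C with (RtoC 0) by ring. now rewrite Cmod_0. }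
    exists (Finite (- d)), (Finite d), (fun t => Psi t x).
    split; [split; simpl; lra|]. split; [exact (H0 x Hx)|].
    apply is_solution_velocity. intros t [T1 T2]. simpl in T1, T2.
    apply HV; [exact Hx|]. apply Rabs_def1; lra.
Qed.

(** All solutions through [x] agree wherever two of them are defined, so they
    glue to one on the union of their intervals, which is an interval because
    each of them contains 0. *)
Lemma greatest_solution (F : C -> C) (x : C) :
  (forall z, exists l, has_C_derivative F z l) ->
  exists alpha omega phi, solution_through F x alpha omega phi /\
    forall alpha' omega' psi, solution_through F x alpha' omega' psi ->
    forall t, in_interval alpha' omega' t -> in_interval alpha omega t /\ psi t = phi t.
Proof.
  intros HF.
  set (V := fun t z => exists alpha omega phi,
    solution_through F x alpha omega phi /\ in_interval alpha omega t /\ phi t = z).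
  set (D := fun t => exists z, V t z).
  assert (V_unique : forall t z w, V t z -> V t w -> z = w).
  { intros t z w (a1 & o1 & f1 & (Z1 & E1 & S1) & T1 & <-)
      (a2 & o2 & f2 & (Z2 & E2 & S2) & T2 & <-).
    apply (solution_uniqueness F a1 o1 a2 o2 f1 f2 0 t); try assumption.
    now rewrite E1, E2. }
  set (phi := fun t => epsilon (inhabits x) (V t)).
  assert (Hphi : forall alpha' omega' psi, solution_through F x alpha' omega' psi ->
    forall t, in_interval alpha' omega' t -> psi t = phi t).
  { intros a o psi Hpsi t Ht. apply (V_unique t).
    - now exists a, o, psi.
    - apply (epsilon_spec (inhabits x) (V t)). exists (psi t). now exists a, o, psi. }
  assert (DI : forall t, in_interval (Glb_Rbar D) (Lub_Rbar D) t <-> D t).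
  { intros t. destruct (Glb_Rbar_correct D) as [G1 G2].
    destruct (Lub_Rbar_correct D) as [L1 L2]. split.
    - intros [T1 T2].
      assert (B1 : exists s, D s /\ s < t).
      { apply NNPP. intros N. apply (Rbar_lt_not_le _ _ T1), G2.
        intros s Hs. apply Rnot_lt_le. intros Hlt. apply N. now exists s. }
      assert (B2 : exists s, D s /\ t < s).
      { apply NNPP. intros N. apply (Rbar_lt_not_le _ _ T2), L2.
        intros s Hs. apply Rnot_lt_le. intros Hlt. apply N. now exists s. }
      destruct B1 as (s1 & (z1 & a1 & o1 & f1 & P1 & I1 & _) & Hs1).
      destruct B2 as (s2 & (z2 & a2 & o2 & f2 & P2 & I2 & _) & Hs2).
      destruct (Rle_dec t 0) as [L|L].
      + exists (f1 t), a1, o1, f1. split; [exact P1|]. split; [|reflexivity].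
        apply (in_interval_convex a1 o1 s1 0); [exact I1|apply P1|lra].
      + exists (f2 t), a2, o2, f2. split; [exact P2|]. split; [|reflexivity].
        apply (in_interval_convex a2 o2 0 s2); [apply P2|exact I2|lra].
    - intros (z & a & o & f & P & I & _).
      destruct (in_interval_open _ _ _ I) as (d & Hd & Hopen).
      assert (Dn : forall s, Rabs (s - t) < d -> D s).
      { intros s Hs. exists (f s), a, o, f.
        split; [exact P|]. split; [apply Hopen, Hs|reflexivity]. }
      split.
      + apply Rbar_le_lt_trans with (Finite (t - d / 2)); [|simpl; lra].
        apply G1, Dn. apply Rabs_def1; lra.
      + apply Rbar_lt_le_trans with (Finite (t + d / 2)); [simpl; lra|].
        apply L1, Dn. apply Rabs_def1; lra. }
  assert (Greatest : forall alpha' omega' psi, solution_through F x alpha' omega' psi ->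
    forall t, in_interval alpha' omega' t ->
    in_interval (Glb_Rbar D) (Lub_Rbar D) t /\ psi t = phi t).
  { intros a o psi Hpsi t Ht. split; [|now apply (Hphi a o psi)].
    apply DI. exists (psi t). now exists a, o, psi. }
  exists (Glb_Rbar D), (Lub_Rbar D), phi. split; [|exact Greatest].
  destruct (local_existence F x HF) as (a0 & o0 & f0 & P0).
  assert (G0 := Greatest a0 o0 f0 P0 0 (proj1 P0)).
  split; [apply G0|]. split; [rewrite <- (proj2 G0); apply P0|].
  apply is_solution_velocity. intros t Ht. apply DI in Ht.
  destruct Ht as (z & a & o & f & P & I & _).
  destruct (in_interval_open _ _ _ I) as (d & Hd & Hopen).
  apply has_velocity_ext_near with f d; [exact Hd| |].
  - intros s Hs. apply (Hphi a o f P), Hopen, Hs.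
  - rewrite <- (Hphi a o f P t I). apply is_solution_velocity with a o; [apply P|exact I].
Qed.

Lemma maximal_solution_exists (F : C -> C) (x : C) :
  (forall z, exists l, has_C_derivative F z l) ->
  exists alpha omega phi, maximal_solution F x alpha omega phi.
Proof.
  intros HF. destruct (greatest_solution F x HF) as (a & o & phi & (H0 & E & S) & G).
  exists a, o, phi. split; [exact H0|]. split; [exact E|]. split; [exact S|].
  intros a' o' psi Hpsi Hext t Ht. destruct (Hext 0 H0) as [I0 E0].
  apply (G a' o' psi); [|exact Ht].
  split; [exact I0|]. split; [now rewrite E0|exact Hpsi].
Qed.

Lemma maximal_solution_greatest (F : C -> C) (x : C) (alpha omega alpha' omega' : Rbar)
    (phi psi : R -> C) :
  (forall z, exists l, has_C_derivative F z l) ->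
  maximal_solution F x alpha omega phi -> solution_through F x alpha' omega' psi ->
  forall t, in_interval alpha' omega' t -> in_interval alpha omega t /\ psi t = phi t.
Proof.
  intros HF (H0 & E & S & M) Hpsi t Ht.
  destruct (greatest_solution F x HF) as (a & o & g & (_ & _ & Sg) & G).
  assert (Gphi := G alpha omega phi (conj H0 (conj E S))).
  assert (Gpsi := G alpha' omega' psi Hpsi t Ht).
  assert (It : in_interval alpha omega t).
  { apply (M a o g Sg); [|apply Gpsi].
    intros s Hs. destruct (Gphi s Hs). now split. }
  split; [exact It|]. rewrite (proj2 Gpsi). symmetry. apply (Gphi t It).
Qed.

Lemma maximal_solution_through (F : C -> C) (x : C) (alpha omega : Rbar) (phi : R -> C) :
  maximal_solution F x alpha omega phi -> solution_through F x alpha omega phi.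
Proof. intros (H1 & H2 & H3 & _). exact (conj H1 (conj H2 H3)). Qed.

Lemma solution_through_shift (F : C -> C) (alpha omega : Rbar) (phi : R -> C) (T : R) :
  is_solution F alpha omega phi -> in_interval alpha omega T ->
  solution_through F (phi T) (Rbar_minus alpha T) (Rbar_minus omega T)
    (fun t => phi (t + T)).
Proof.
  intros H HT. split; [|split].
  - apply in_interval_shift. now rewrite Rplus_0_l.
  - now rewrite Rplus_0_l.
  - now apply is_solution_shift.
Qed.

Lemma maximal_solution_shift (F : C -> C) (x : C) (alpha omega : Rbar) (phi : R -> C) (T : R) :
  maximal_solution F x alpha omega phi -> in_interval alpha omega T ->
  maximal_solution F (phi T) (Rbar_minus alpha T) (Rbar_minus omega T)
    (fun t => phi (t + T)).
Proof.
  intros (H0 & E & S & M) HT.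
  destruct (solution_through_shift F alpha omega phi T S HT) as (H1 & H2 & H3).
  split; [exact H1|]. split; [exact H2|]. split; [exact H3|].
  intros a o psi Hpsi Hext t Ht. apply in_interval_shift.
  apply (M (Rbar_minus a (- T)) (Rbar_minus o (- T)) (fun s => psi (s + - T))).
  - now apply is_solution_shift.
  - intros s Hs.
    assert (Hs' : in_interval (Rbar_minus alpha T) (Rbar_minus omega T) (s + - T)).
    { apply in_interval_shift. now replace (s + - T + T) with s by ring. }
    destruct (Hext _ Hs') as [X1 X2]. split.
    + now apply in_interval_shift.
    + rewrite X2. f_equal. ring.
  - apply in_interval_shift. now replace (t + T + - T) with t by ring.
Qed.

Lemma maximal_solution_opp (F : C -> C) (x : C) (alpha omega : Rbar) (phi : R -> C) :
  maximal_solution F x alpha omega phi ->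
  maximal_solution (fun z => - F z)%C x (Rbar_opp omega) (Rbar_opp alpha)
    (fun t => phi (- t)).
Proof.
  intros (H0 & E & S & M).
  split; [apply in_interval_opp; now rewrite Ropp_0|].
  split; [now rewrite Ropp_0|]. split; [now apply is_solution_opp|].
  intros a o psi Hpsi Hext t Ht. apply in_interval_opp.
  apply (M (Rbar_opp o) (Rbar_opp a) (fun s => psi (- s))).
  - apply is_solution_opp in Hpsi. intros s Hs.
    specialize (Hpsi s Hs). cbv beta in Hpsi.
    replace (F (psi (- s))) with (- - F (psi (- s)%R))%C by ring. exact Hpsi.
  - intros s Hs.
    destruct (Hext (- s)) as [X1 X2].
    + apply in_interval_opp. now rewrite Ropp_involutive.
    + split; [now apply in_interval_opp|]. rewrite X2. now rewrite Ropp_involutive.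
  - apply in_interval_opp. now rewrite Ropp_involutive.
Qed.

(** * The basin as the set of points whose orbit meets a small disc *)

(** The time [T] may have either sign: the basin is a union of full orbits. *)
Definition reaches (F : C -> C) (a : C) (eps : R) (x : C) : Prop :=
  exists alpha omega phi T, solution_through F x alpha omega phi /\
    in_interval alpha omega T /\ Cmod (phi T - a) < eps.

Lemma Rbar_locally_shift (e : Rbar) (T : R) (Q : R -> Prop) :
  Rbar_locally (Rbar_minus e T) Q -> Rbar_locally e (fun t => Q (t - T)).
Proof.
  destruct e as [r| |]; simpl.
  - intros [d Hd]. exists d. intros t Ht. apply Hd.
    assert (E : (t - T) - (r - T) = t - r) by ring.
    change (Rabs ((t - T) - (r - T)) < d). rewrite E. exact Ht.
  - intros [M HM]. exists (M + T). intros t Ht. apply HM. lra.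
  - intros [M HM]. exists (M + T). intros t Ht. apply HM. lra.
Qed.

Lemma Rbar_locally_opp_time (e : Rbar) (Q : R -> Prop) :
  Rbar_locally (Rbar_opp e) Q -> Rbar_locally e (fun t => Q (- t)).
Proof.
  destruct e as [r| |]; simpl.
  - intros [d Hd]. exists d. intros t Ht. apply Hd.
    change (Rabs (- t - - r) < d).
    replace (- t - - r) with (- (t - r)) by ring. rewrite Rabs_Ropp. exact Ht.
  - intros [M HM]. exists (- M). intros t Ht. apply HM. lra.
  - intros [M HM]. exists (- M). intros t Ht. apply HM. lra.
Qed.

Lemma limit_along_unique (alpha omega e : Rbar) (phi : R -> C) (a p : C) :
  filterlim phi (within (in_interval alpha omega) (Rbar_locally e)) (locally a) ->
  limit_along alpha omega phi e p -> p = a.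
Proof.
  intros Ha (t & Ht & Hlim & Hp).
  assert (Ha' : filterlim (fun n => phi (t n)) eventually (locally a)).
  { apply filterlim_comp with (2 := Ha). intros Q HQ.
    specialize (Hlim _ HQ). unfold filtermap in *.
    destruct Hlim as [n0 Hn]. exists n0. intros n Hle. apply Hn; [exact Hle|apply Ht]. }
  exact (@filterlim_locally_unique nat R_AbsRing C_R_NormedModule eventually
    _ (fun n => phi (t n)) p a Hp Ha').
Qed.

Lemma limit_along_right_end (alpha omega : Rbar) (phi : R -> C) (a : C) (t0 : R) :
  in_interval alpha omega t0 ->
  filterlim phi (within (in_interval alpha omega) (Rbar_locally omega)) (locally a) ->
  limit_along alpha omega phi omega a.
Proof.
  intros H0 Ha. destruct (sequence_to_right_end _ _ _ H0) as (u & Hu & Hlim).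
  exists u. split; [exact Hu|]. split; [exact Hlim|].
  apply filterlim_comp with (2 := Ha). intros Q HQ.
  specialize (Hlim _ HQ). unfold filtermap in *.
  destruct Hlim as [n0 Hn]. exists n0. intros n Hle. apply Hn; [exact Hle|apply Hu].
Qed.

(** If [a] is a limit point, then the orbit enters the disc in which all forward
    orbits converge to [a]. Conversely an orbit meeting that disc converges
    to [a], so that [a] is its only limit point. *)
Theorem attracting_basin_reaches (F : C -> C) (a : C) (N : C -> Prop) :
  (forall z, exists l, has_C_derivative F z l) -> attracting F a ->
  (forall x, N x <-> (forall p, w_plus F x p <-> p = a)) ->
  exists eps, 0 < eps /\ forall x, N x <-> reaches F a eps x.
Proof.
  intros HF (U & HU & Hatt) HN.
  apply locally_Cmod in HU. destruct HU as (eps & Heps & HU).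
  exists eps. split; [exact Heps|]. intros x. rewrite HN. split.
  - intros Hw. destruct (proj2 (Hw a) eq_refl) as (al & om & phi & Hmax & (t & Ht & _ & Hlim)).
    assert (Hball : locally a (fun z => Cmod (z - a) < eps))
      by (apply locally_Cmod; exists eps; tauto).
    destruct (Hlim _ Hball) as [n Hn].
    exists al, om, phi, (t n). split; [exact (maximal_solution_through _ _ _ _ _ Hmax)|].
    split; [apply Ht|]. apply (Hn n (le_n n)).
  - intros (al & om & phi & T & Hphi & HT & Hreach).
    assert (Conv : forall al' om' psi, maximal_solution F x al' om' psi ->
      filterlim psi (within (in_interval al' om') (Rbar_locally om')) (locally a)).
    { intros al' om' psi Hmax.
      destruct (maximal_solution_greatest F x _ _ _ _ _ _ HF Hmax Hphi T HT) as [IT ET].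
      assert (HC := Hatt (psi T)). rewrite <- ET in HC.
      specialize (HC (HU _ Hreach)). rewrite ET in HC.
      specialize (HC _ _ _ (maximal_solution_shift _ _ _ _ _ _ Hmax IT)).
      intros Q HQ. specialize (HC Q HQ). unfold filtermap, within in *.
      apply Rbar_locally_shift in HC.
      revert HC. apply filter_imp. intros t Ht It.
      replace t with (t - T + T) by ring. apply Ht.
      apply in_interval_shift. now replace (t - T + T) with t by ring. }
    intros p. split.
    + intros (al' & om' & psi & Hmax & Hlim).
      exact (limit_along_unique _ _ _ _ _ _ (Conv _ _ _ Hmax) Hlim).
    + intros ->. destruct (maximal_solution_exists F x HF) as (al' & om' & psi & Hmax).
      exists al', om', psi. split; [exact Hmax|].
      exact (limit_along_right_end _ _ _ _ 0 (proj1 Hmax) (Conv _ _ _ Hmax)).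
Qed.

(** * Invariance and openness *)

Lemma reaches_invariant (F : C -> C) (a : C) (eps : R) (x : C)
    (alpha omega : Rbar) (phi : R -> C) (T : R) :
  (forall z, exists l, has_C_derivative F z l) ->
  solution_through F x alpha omega phi -> in_interval alpha omega T ->
  reaches F a eps (phi T) -> reaches F a eps x.
Proof.
  intros HF Hphi HT (al & om & psi & S & Hpsi & HS & Hreach).
  destruct (maximal_solution_exists F x HF) as (A & O & Phi & Hmax).
  destruct (maximal_solution_greatest F x _ _ _ _ _ _ HF Hmax Hphi T HT) as [IT ET].
  assert (Hsh := maximal_solution_shift _ _ _ _ _ _ Hmax IT).
  rewrite ET in Hpsi.
  destruct (maximal_solution_greatest F _ _ _ _ _ _ _ HF Hsh Hpsi S HS) as [IS ES].
  exists A, O, Phi, (S + T). split; [now apply maximal_solution_through|].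
  split; [now apply in_interval_shift|]. now rewrite <- ES.
Qed.

Lemma disc_reaches (F : C -> C) (a : C) (eps : R) (x : C) :
  (forall z, exists l, has_C_derivative F z l) ->
  Cmod (x - a) < eps -> reaches F a eps x.
Proof.
  intros HF Hx. destruct (local_existence F x HF) as (al & om & phi & Hphi).
  exists al, om, phi, 0. split; [exact Hphi|].
  destruct Hphi as (H0 & E & _). split; [exact H0|]. now rewrite E.
Qed.

Lemma reaches_forward (F : C -> C) (a : C) (eps : R) (x : C)
    (alpha omega : Rbar) (phi : R -> C) (T : R) :
  (forall z, exists l, has_C_derivative F z l) ->
  solution_through F x alpha omega phi -> in_interval alpha omega T ->
  reaches F a eps x -> reaches F a eps (phi T).
Proof.
  intros HF (H0 & E & S) HT Hx.
  apply (reaches_invariant F a eps (phi T) _ _ _ (- T) HF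
    (solution_through_shift F alpha omega phi T S HT)).
  - apply in_interval_shift. now replace (- T + T) with 0 by ring.
  - cbv beta. replace (- T + T) with 0 by ring. now rewrite E.
Qed.

(** Near a regular point of the orbit, the local flow carries a neighbourhood of
    [phi t] into a given neighbourhood of [phi u], and a point whose orbit passes
    through the basin is in the basin. Near an equilibrium [phi] is constant. *)
Lemma reaches_interior_along_orbit (F : C -> C) (a : C) (eps : R)
    (alpha omega : Rbar) (phi : R -> C) (s : R) :
  (forall z, exists l, has_C_derivative F z l) ->
  is_solution F alpha omega phi -> in_interval alpha omega s ->
  exists delta, 0 < delta /\ forall t, Rabs (t - s) < delta ->
    (C_interior (reaches F a eps) (phi t) <->
     C_interior (reaches F a eps) (phi s)).
Proof.
  intros HF Hphi Hs.
  destruct (classic (F (phi s) = 0%C)) as [Z|NZ].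
  - destruct (HF (phi s)) as [l Hl].
    destruct (equilibrium_locally_constant F phi s l Hl Z
      (is_solution_solves_near _ _ _ _ _ Hphi Hs)) as (d & Hd & H).
    exists d. split; [exact Hd|]. intros t Ht. now rewrite (H t Ht).
  - destruct (local_flow F (phi s) HF NZ)
      as (rho & d & K & Psi & Hrho & Hd & HK & P0 & PV & PL).
    destruct (in_interval_open _ _ _ Hs) as (d1 & Hd1 & HI).
    destruct (has_velocity_continuous _ _ _
      (proj1 (is_solution_velocity _ _ _ _) Hphi s Hs) rho Hrho) as (d2 & Hd2 & HC).
    set (e := Rmin (d / 2) (Rmin d1 d2)).
    assert (He : 0 < e) by (unfold e; repeat apply Rmin_glb_lt; lra).
    assert (He' : forall t, Rabs (t - s) < e ->
      Rabs (t - s) < d / 2 /\ in_interval alpha omega t /\ Cmod (phi t - phi s) < rho).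
    { intros t Ht. unfold e in Ht.
      assert (M1 := Rmin_l (d / 2) (Rmin d1 d2)).
      assert (M2 := Rmin_r (d / 2) (Rmin d1 d2)).
      assert (M3 := Rmin_l d1 d2). assert (M4 := Rmin_r d1 d2).
      split; [lra|]. split; [apply HI|apply HC]; lra. }
    assert (Step : forall t u, Rabs (t - s) < e -> Rabs (u - s) < e ->
      C_interior (reaches F a eps) (phi u) ->
      C_interior (reaches F a eps) (phi t)).
    { intros t u Ht Hu Hint. apply locally_Cmod in Hint.
      destruct Hint as (r & Hr & Hint).
      destruct (He' t Ht) as (T1 & T2 & T3). destruct (He' u Hu) as (U1 & U2 & U3).
      assert (Htau : Rabs (u - t) < d).
      { apply Rabs_def2 in T1, U1. apply Rabs_def1; lra. }
      assert (Sol : forall y, Cmod (y - phi s) < rho ->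
        solution_through F y (Finite (- d)) (Finite d) (fun v => Psi v y)).
      { intros y Hy. split; [split; simpl; lra|]. split; [exact (P0 y Hy)|].
        apply is_solution_velocity. intros v [V1 V2]. simpl in V1, V2.
        apply PV; [exact Hy|]. apply Rabs_def1; lra. }
      assert (Iut : in_interval (Finite (- d)) (Finite d) (u - t)).
      { apply Rabs_def2 in Htau. split; simpl; lra. }
      assert (E : Psi (u - t) (phi t) = phi u).
      { assert (Sh := solution_through_shift F alpha omega phi t Hphi T2).
        replace (phi u) with ((fun v => phi (v + t)) (u - t)) by (f_equal; ring).
        destruct (Sol (phi t) T3) as (A1 & A2 & A3). destruct Sh as (B1 & B2 & B3).
        apply (solution_uniqueness F _ _ _ _ _ _ 0 (u - t) HF A3 B3); try assumption.
        - apply in_interval_shift. now replace (u - t + t) with u by ring.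
        - now rewrite A2, B2. }
      apply locally_Cmod. exists (Rmin (rho - Cmod (phi t - phi s)) (r / K)).
      split; [apply Rmin_glb_lt; [lra|apply Rdiv_lt_0_compat; lra]|].
      intros y Hy.
      assert (M1 := Rmin_l (rho - Cmod (phi t - phi s)) (r / K)).
      assert (M2 := Rmin_r (rho - Cmod (phi t - phi s)) (r / K)).
      assert (Hyp : Cmod (y - phi s) < rho)
        by (assert (Tri := Cmod_sub_triangle y (phi t) (phi s)); lra).
      apply (reaches_invariant F a eps y _ _ _ (u - t) HF (Sol y Hyp) Iut).
      apply Hint. rewrite <- E.
      eapply Rle_lt_trans; [apply PL; assumption|].
      apply Rlt_le_trans with (K * (r / K)); [apply Rmult_lt_compat_l; lra|].
      right; field; lra. }
    exists e. split; [exact He|]. intros t Ht.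
    assert (Hss : Rabs (s - s) < e) by (rewrite Rminus_diag, Rabs_R0; lra).
    split; apply Step; assumption.
Qed.

(** Being interior holds at the time when the orbit is in the disc, and the
    previous lemma propagates it along the orbit back to [x]. *)
Lemma reaches_interior (F : C -> C) (a : C) (eps : R) (x : C) :
  (forall z, exists l, has_C_derivative F z l) ->
  reaches F a eps x -> C_interior (reaches F a eps) x.
Proof.
  intros HF (al & om & phi & T & (H0 & E & S) & HT & Hreach).
  rewrite <- E.
  apply (locally_constant_on_interval (in_interval al om)
    (fun t => C_interior (reaches F a eps) (phi t))) with (s := T); try assumption.
  - intros s t u. apply in_interval_convex.
  - intros t Ht.
    destruct (reaches_interior_along_orbit F a eps al om phi t HF S Ht) as (d & Hd & H).
    exists d. split; [exact Hd|]. intros s _. apply H.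
  - apply locally_Cmod. exists (eps - Cmod (phi T - a)). split; [lra|].
    intros y Hy. apply disc_reaches; [exact HF|].
    assert (Tri := Cmod_sub_triangle y (phi T) a). lra.
Qed.

(** * Paths *)

(** Continuity is required at all times, not only on [0, 1], so that
    paths can be composed with [clamp] and concatenated without case analysis. *)
Definition joined (A : C -> Prop) (x y : C) : Prop :=
  exists gamma : R -> C, (forall t, continuous_at gamma t) /\
    gamma 0 = x /\ gamma 1 = y /\ forall s, 0 <= s <= 1 -> A (gamma s).

Lemma continuous_at_lipschitz_time (gamma : R -> C) (c : R -> R) (k : R) :
  0 < k -> (forall s t, Rabs (c s - c t) <= k * Rabs (s - t)) ->
  (forall t, continuous_at gamma (c t)) ->
  forall t, continuous_at (fun s => gamma (c s)) t.
Proof.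
  intros Hk Hc Hg t e He. destruct (Hg t e He) as (d & Hd & H).
  exists (d / k). split; [apply Rdiv_lt_0_compat; lra|].
  intros s Hs. apply H. eapply Rle_lt_trans; [apply Hc|].
  apply Rlt_le_trans with (k * (d / k)); [apply Rmult_lt_compat_l; lra|].
  right; field; lra.
Qed.

Definition clamp (t : R) : R := Rmax 0 (Rmin 1 t).

Lemma clamp_lipschitz (s t : R) : Rabs (clamp s - clamp t) <= Rabs (s - t).
Proof.
  unfold clamp, Rmax, Rmin.
  repeat destruct Rle_dec; unfold Rabs; repeat destruct Rcase_abs; lra.
Qed.

Lemma clamp_range (t : R) : 0 <= clamp t <= 1.
Proof. unfold clamp, Rmax, Rmin. repeat destruct Rle_dec; lra. Qed.

Lemma clamp_ge (t : R) : 1 <= t -> clamp t = 1.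
Proof. intros H. unfold clamp, Rmax, Rmin. repeat destruct Rle_dec; lra. Qed.

Lemma clamp_le (t : R) : t <= 0 -> clamp t = 0.
Proof. intros H. unfold clamp, Rmax, Rmin. repeat destruct Rle_dec; lra. Qed.

Lemma joined_sym (A : C -> Prop) (x y : C) : joined A x y -> joined A y x.
Proof.
  intros (g & Hg & H0 & H1 & HA). exists (fun s => g (1 - s)).
  split; [|split; [|split]].
  - intros t. apply (continuous_at_lipschitz_time g (fun s => 1 - s) 1); [lra| |auto].
    intros s u. replace (1 - s - (1 - u)) with (- (s - u)) by ring.
    rewrite Rabs_Ropp. lra.
  - now rewrite Rminus_0_r.
  - now rewrite Rminus_diag.
  - intros s Hs. apply HA. lra.
Qed.

Lemma joined_trans (A : C -> Prop) (x y z : C) :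
  joined A x y -> joined A y z -> joined A x z.
Proof.
  intros (g & Hg & G0 & G1 & GA) (h & Hh & H0 & H1 & HA).
  assert (L : forall b s u, Rabs (clamp (2 * s - b) - clamp (2 * u - b)) <= 2 * Rabs (s - u)).
  { intros b s u. eapply Rle_trans; [apply clamp_lipschitz|].
    replace (2 * s - b - (2 * u - b)) with (2 * (s - u)) by ring.
    rewrite Rabs_mult, Rabs_pos_eq; lra. }
  (* Up to time 1/2 the second path rests at y, afterwards the first one does;
     subtracting y leaves the moving one. *)
  exists (fun s => g (clamp (2 * s - 0)) + h (clamp (2 * s - 1)) - y)%C.
  split; [|split; [|split]].
  - intros t e He.
    destruct (continuous_at_lipschitz_time g (fun s => clamp (2 * s - 0)) 2
      ltac:(lra) (L 0) (fun u => Hg _) t (e / 2) ltac:(lra)) as (d1 & Hd1 & C1).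
    destruct (continuous_at_lipschitz_time h (fun s => clamp (2 * s - 1)) 2
      ltac:(lra) (L 1) (fun u => Hh _) t (e / 2) ltac:(lra)) as (d2 & Hd2 & C2).
    exists (Rmin d1 d2). split; [apply Rmin_glb_lt; lra|]. intros s Hs.
    assert (M1 := Rmin_l d1 d2). assert (M2 := Rmin_r d1 d2).
    specialize (C1 s ltac:(lra)). specialize (C2 s ltac:(lra)).
    set (g1 := g (clamp (2 * s - 0))) in *. set (g0 := g (clamp (2 * t - 0))) in *.
    set (h1 := h (clamp (2 * s - 1))) in *. set (h0 := h (clamp (2 * t - 1))) in *.
    replace (g1 + h1 - y - (g0 + h0 - y))%C with ((g1 - g0) + (h1 - h0))%C by ring.
    assert (Tri := Cmod_triangle (g1 - g0) (h1 - h0)). lra.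
  - rewrite !clamp_le by lra. rewrite G0, H0. ring.
  - rewrite (clamp_ge (2 * 1 - 0)), (clamp_ge (2 * 1 - 1)) by lra.
    rewrite G1, H1. ring.
  - intros s Hs. destruct (Rle_dec s (1 / 2)) as [Hh2|Hh2].
    + rewrite (clamp_le (2 * s - 1)), H0 by lra.
      replace (g (clamp (2 * s - 0)) + y - y)%C with (g (clamp (2 * s - 0)))
        by (set (q := g _); ring).
      apply GA, clamp_range.
    + rewrite (clamp_ge (2 * s - 0)), G1 by lra.
      replace (y + h (clamp (2 * s - 1)) - y)%C with (h (clamp (2 * s - 1)))
        by (set (q := h _); ring).
      apply HA, clamp_range.
Qed.

Lemma joined_path_connected (A : C -> Prop) :
  (forall x y, A x -> A y -> joined A x y) -> path_connected A.
Proof.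
  intros H x y Hx Hy. destruct (H x y Hx Hy) as (g & Hg & G0 & G1 & GA).
  exists g. split; [|tauto].
  intros s _ Q HQ. apply locally_Cmod in HQ. destruct HQ as (e & He & HQ).
  destruct (Hg s e He) as (d & Hd & HC).
  exists (mkposreal d Hd). intros t Ht _. apply HQ, HC, Ht.
Qed.

Lemma joined_connected (A : C -> Prop) :
  (forall x y, A x -> A y -> joined A x y) -> connected A.
Proof.
  intros H (U & V & HU & HV & Hcov & (x & Ax & Ux) & (y & Ay & Vy) & Hdis).
  destruct (H x y Ax Ay) as (g & Hg & G0 & G1 & GA).
  assert (Open : forall W : C -> Prop, open W -> forall t, W (g t) ->
    exists d, 0 < d /\ forall s, Rabs (s - t) < d -> W (g s)).
  { intros W HW t Wt. assert (L := HW _ Wt). apply locally_Cmod in L.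
    destruct L as (e & He & L). destruct (Hg t e He) as (d & Hd & HC).
    exists d. split; [exact Hd|]. intros s Hs. apply L, HC, Hs. }
  apply (Hdis y). split; [exact Ay|]. split; [|exact Vy].
  rewrite <- G1.
  apply (locally_constant_on_interval (fun s => 0 <= s <= 1) (fun s => U (g s)))
    with (s := 0); try lra.
  - intros s t u. lra.
  - intros t Ht. destruct (Hcov _ (GA t Ht)) as [Ut|Vt].
    + destruct (Open U HU t Ut) as (d & Hd & HC).
      exists d. split; [exact Hd|]. intros s _ Hsd. specialize (HC s Hsd). tauto.
    + destruct (Open V HV t Vt) as (d & Hd & HC).
      exists d. split; [exact Hd|]. intros s Hs Hsd.
      assert (N1 := Hdis (g s)). assert (N2 := Hdis (g t)).
      assert (A1 := GA s Hs). assert (A2 := GA t Ht).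
      specialize (HC s Hsd). tauto.
  - now rewrite G0.
Qed.

(** Follow the orbit into the disc, then a radius to [a]. *)
Lemma reaches_joined_center (F : C -> C) (a : C) (eps : R) (x : C) :
  (forall z, exists l, has_C_derivative F z l) ->
  reaches F a eps x -> joined (reaches F a eps) x a.
Proof.
  intros HF Hx. assert (Hx' := Hx).
  destruct Hx' as (al & om & phi & T & (H0 & E & S) & HT & Hreach).
  assert (Irange : forall s, in_interval al om (T * clamp s)).
  { intros s. assert (R := clamp_range s). destruct (Rle_dec 0 T).
    - apply (in_interval_convex al om 0 T); [exact H0|exact HT|nra].
    - apply (in_interval_convex al om T 0); [exact HT|exact H0|nra]. }
  apply joined_trans with (phi T).
  - exists (fun s => phi (T * clamp s)). split; [|split; [|split]].
    + intros t. apply (continuous_at_lipschitz_time phi (fun s => T * clamp s) (Rabs T + 1)).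
      * assert (P := Rabs_pos T). lra.
      * intros s u. replace (T * clamp s - T * clamp u) with (T * (clamp s - clamp u)) by ring.
        rewrite Rabs_mult. apply Rmult_le_compat; try apply Rabs_pos; [lra|].
        apply clamp_lipschitz.
      * intros u. unfold continuous_at.
        exact (has_velocity_continuous _ _ _
          (proj1 (is_solution_velocity _ _ _ _) S _ (Irange u))).
    + rewrite clamp_le by lra. now rewrite Rmult_0_r.
    + rewrite clamp_ge by lra. now rewrite Rmult_1_r.
    + intros s _. apply (reaches_forward F a eps x al om phi _ HF (conj H0 (conj E S)));
        [apply Irange|exact Hx].
  - set (q := phi T) in *. exists (fun s => q + RtoC s * (a - q))%C.
    split; [|split; [|split]].
    + intros t e He. assert (P := Cmod_ge_0 (a - q)).
      exists (e / (Cmod (a - q) + 1)). split; [apply Rdiv_lt_0_compat; lra|].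
      intros s Hs.
      replace (q + RtoC s * (a - q) - (q + RtoC t * (a - q)))%C
        with (RtoC (s - t) * (a - q))%C by (rewrite RtoC_minus; ring).
      rewrite Cmod_mult, Cmod_R.
      apply Rlt_div_r in Hs; [|lra]. assert (P' := Rabs_pos (s - t)). nra.
    + ring.
    + ring.
    + intros s Hs. apply disc_reaches; [exact HF|].
      replace (q + RtoC s * (a - q) - a)%C with (RtoC (1 - s) * (q - a))%C
        by (rewrite RtoC_minus; ring).
      rewrite Cmod_mult, Cmod_R, Rabs_pos_eq by lra.
      assert (P := Cmod_ge_0 (q - a)). nra.
Qed.

Theorem attracting_basin_topology (F : C -> C) (a : C) (N : C -> Prop) :
  (forall z, exists l, has_C_derivative F z l) -> attracting F a ->
  (forall x, N x <-> (forall p, w_plus F x p <-> p = a)) ->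
  C_interior N a /\ open N /\ connected N /\ path_connected N.
Proof.
  intros HF Hatt HN.
  destruct (attracting_basin_reaches F a N HF Hatt HN) as (eps & Heps & HR).
  assert (Hopen : forall x, N x -> locally x N).
  { intros x Hx. apply HR in Hx. apply (reaches_interior F a eps x HF) in Hx.
    apply locally_Cmod in Hx. destruct Hx as (r & Hr & Hx). apply locally_Cmod. exists r.
    split; [exact Hr|]. intros y Hy. apply HR, Hx, Hy. }
  assert (Hjoin : forall x y, N x -> N y -> joined N x y).
  { intros x y Hx Hy. apply HR in Hx, Hy.
    destruct (joined_trans _ _ _ _ (reaches_joined_center F a eps x HF Hx)
      (joined_sym _ _ _ (reaches_joined_center F a eps y HF Hy)))
      as (g & G & G0 & G1 & GA).
    exists g. repeat split; try assumption. intros s Hs. apply HR, GA, Hs. }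
  split; [|split; [|split]].
  - apply Hopen, HR, disc_reaches; [exact HF|].
    replace (a - a)%C with (RtoC 0) by ring. now rewrite Cmod_0.
  - exact Hopen.
  - now apply joined_connected.
  - now apply joined_path_connected.
Qed.

(** * Reversal of time *)

Lemma limit_along_opp (alpha omega e : Rbar) (phi : R -> C) (p : C) :
  limit_along alpha omega phi e p ->
  limit_along (Rbar_opp omega) (Rbar_opp alpha) (fun t => phi (- t)) (Rbar_opp e) p.
Proof.
  intros (t & Ht & Hlim & Hp). exists (fun n => - t n). split; [|split].
  - intros n. apply in_interval_opp. rewrite Ropp_involutive. apply Ht.
  - now apply -> is_lim_seq_opp.
  - apply filterlim_ext with (2 := Hp). intros n. now rewrite Ropp_involutive.
Qed.

Lemma double_opp_field (F : C -> C) : (fun z => - - F z)%C = F.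
Proof. apply functional_extensionality. intros z. ring. Qed.

Lemma w_minus_opp (F : C -> C) (x p : C) :
  w_minus F x p <-> w_plus (fun z => - F z)%C x p.
Proof.
  split; intros (al & om & phi & Hmax & Hlim);
    exists (Rbar_opp om), (Rbar_opp al), (fun t => phi (- t));
    apply maximal_solution_opp in Hmax; (split; [|now apply limit_along_opp]).
  - exact Hmax.
  - now rewrite double_opp_field in Hmax.
Qed.

Lemma repelling_opp (F : C -> C) (a : C) :
  repelling F a -> attracting (fun z => - F z)%C a.
Proof.
  intros (U & HU & H). exists U. split; [exact HU|].
  intros x Hx al om phi Hmax.
  apply maximal_solution_opp in Hmax. rewrite double_opp_field in Hmax.
  specialize (H x Hx _ _ _ Hmax).
  intros Q HQ. specialize (H Q HQ). unfold filtermap, within in *.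
  apply Rbar_locally_opp_time in H.
  revert H. apply filter_imp. intros t Ht It.
  rewrite Ropp_involutive in Ht. apply Ht.
  apply in_interval_opp. now rewrite Ropp_involutive.
Qed.

Lemma has_C_derivative_opp (F : C -> C) (z l : C) :
  has_C_derivative F z l -> has_C_derivative (fun w => - F w)%C z (- l).
Proof.
  intros H eps Heps. destruct (H eps Heps) as (d & Hd & B).
  exists d. split; [exact Hd|]. intros w Hw.
  replace (- F w - - F z - - l * (w - z))%C with (- (F w - F z - l * (w - z)))%C by ring.
  rewrite Cmod_opp. apply B, Hw.
Qed.

Theorem theorem4p3 (F : C -> C) (a : C) (N : C -> Prop)
  (hF : entire F) (hF0 : ~ (forall z : C, F z = RtoC 0))
  (ha : node_or_focus F a) (hN : is_basin F a N) :
  C_interior N a /\ open N /\ connected N /\ path_connected N.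
Proof.
  assert (HF : forall z, exists l, has_C_derivative F z l).
  { intros z. destruct (hF z) as [l Hl]. exists l.
    now apply has_C_derivative_of_is_derive. }
  destruct hN as [[Hatt HN]|[Hrep HN]].
  - exact (attracting_basin_topology F a N HF Hatt HN).
  - apply (attracting_basin_topology (fun z => - F z)%C a N).
    + intros z. destruct (HF z) as [l Hl]. exists (- l)%C.
      now apply has_C_derivative_opp.
    + now apply repelling_opp.
    + intros x. rewrite HN. split; intros H p; rewrite <- (H p);
        [symmetry|]; apply w_minus_opp.
Qed.
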